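(* Let $1<p,q<\infty$ with $q\neq2$. Then there exists a Calderón–Zygmund operator $T$ on $\mathbb{R}^n$ which is not bounded on $M^{p,q}(\mathbb{R}^n)$, i.e. there is no constant $C$ with $\|Tf\|_{M^{p,q}}\le C\|f\|_{M^{p,q}}$ for all $f\in\mathcal{S}(\mathbb{R}^n)$.
   Context: A Calderón–Zygmund operator is an $L^2(\mathbb{R}^n)$-bounded linear operator whose distributional kernel coincides, outside the diagonal $\{x=y\}$, with a function $K(x,y)$ satisfying, for some $0<\epsilon\le1$ and $C>0$: $|K(x,y)|\le C|x-y|^{-n}$; $|K(x,y)-K(x',y)|\le C|x-x'|^\epsilon|x-y|^{-n-\epsilon}$ for $|x-y|>2|x-x'|$; $|K(x,y)-K(x,y')|\le C|y-y'|^\epsilon|x-y|^{-n-\epsilon}$ for $|x-y|>2|y-y'|$. Modulation spaces: fix a window $\gamma\in\mathcal{S}(\mathbb{R}^n)\setminus\{0\}$, set $V_\gamma f(x,\xi)=(f,M_\xi T_x\gamma)$ with $M_\xi\gamma(t)=e^{i\xi\cdot t}\gamma(t)$, $T_x\gamma(t)=\gamma(t-x)$; $M^{p,q}(\mathbb{R}^n)$ is the set of $f\in\mathcal{S}'(\mathbb{R}^n)$ with $\|f\|_{M^{p,q}}=\|(\int|V_\gamma f(x,\xi)|^pdx)^{1/p}\|_{L^q_\xi}<\infty$. *)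

(* Defs.v *)
From mathcomp Require Import all_boot all_algebra.
From mathcomp Require Import all_classical all_reals all_analysis.
From mathcomp Require Import complex.
Import Num.Theory GRing.Theory numFieldTopology.Exports numFieldNormedType.Exports.

Set Implicit Arguments.
Unset Strict Implicit.
Unset Printing Implicit Defensive.

Local Open Scope classical_set_scope.
Local Open Scope ring_scope.

Definition dotRn (R : realType) (n : nat) (x y : 'rV[R]_n) : R :=
  \sum_(i < n) x 0 i * y 0 i.

Definition enorm (R : realType) (n : nat) (x : 'rV[R]_n) : R :=
  Num.sqrt (\sum_(i < n) x 0 i ^+ 2).

Definition cmod (R : realType) (z : R[i]) : R :=
  Num.sqrt (complex.Re z ^+ 2 + complex.Im z ^+ 2).

Definition expi (R : realType) (t : R) : R[i] := Complex (cos t) (sin t).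

Definition rowOfSeq (R : realType) (n : nat) (s : seq R) : 'rV[R]_n :=
  \row_(i < n) nth 0 s i.

Fixpoint iterint (R : realType) (k : nat) (F : seq R -> \bar R) : \bar R :=
  match k with
  | 0%N => F [::]
  | k'.+1 => (\int[@lebesgue_measure R]_(x in [set: R])
                 iterint k' (fun s => F (x :: s)))%E
  end.

Definition intRn (R : realType) (n : nat) (f : 'rV[R]_n -> \bar R) : \bar R :=
  iterint n (fun s => f (rowOfSeq n s)).

Definition cint (R : realType) (n : nat) (h : 'rV[R]_n -> R[i]) : R[i] :=
  Complex (fine (intRn (fun x => (complex.Re (h x))%:E)))
          (fine (intRn (fun x => (complex.Im (h x))%:E))).

Definition L2sq (R : realType) (n : nat) (f : 'rV[R]_n -> R[i]) : \bar R :=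
  intRn (fun x => (cmod (f x) ^+ 2)%:E).

Definition borel_fun (R : realType) (n : nat) (h : 'rV[R]_n -> R) : Prop :=
  forall U : set R, open U ->
    <<s [set A : set 'rV[R]_n | open A] >> (h @^-1` U).

Definition borel_cfun (R : realType) (n : nat) (h : 'rV[R]_n -> R[i]) : Prop :=
  borel_fun (fun x => complex.Re (h x)) /\ borel_fun (fun x => complex.Im (h x)).

Fixpoint pder (R : realType) (n : nat) (ds : seq 'I_n) (g : 'rV[R]_n -> R)
  : 'rV[R]_n -> R :=
  match ds with
  | [::] => g
  | i :: ds' => fun x => derive (pder ds' g) x (delta_mx 0 i)
  end.

Definition schwartz_real (R : realType) (n : nat) (g : 'rV[R]_n -> R) : Prop :=
  (forall (ds : seq 'I_n) (i : 'I_n) (x : 'rV[R]_n),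
      derivable (pder ds g) x (delta_mx 0 i)) /\
  (forall (ds : seq 'I_n) (N : nat), exists C : R,
      forall x : 'rV[R]_n, (1 + enorm x) ^+ N * `|pder ds g x| <= C).

Definition schwartz (R : realType) (n : nat) (f : 'rV[R]_n -> R[i]) : Prop :=
  schwartz_real (fun x => complex.Re (f x)) /\
  schwartz_real (fun x => complex.Im (f x)).

Definition supp (R : realType) (n : nat) (f : 'rV[R]_n -> R[i]) : set 'rV[R]_n :=
  closure [set x | f x != 0].

Definition test_fun (R : realType) (n : nat) (f : 'rV[R]_n -> R[i]) : Prop :=
  schwartz f /\ compact (supp f).

(* T is given by its action on the Schwartz class S(R^n) (which is dense in L^2,
   so an L^2-bounded linear operator is the same as a linear map on S that is
   bounded for the L^2 norm); T f is a (Borel) function in L^2. *)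
Definition CZ_kernel (R : realType) (n : nat) (K : 'rV[R]_n -> 'rV[R]_n -> R[i])
  (eps C : R) : Prop :=
  [/\ 0 < eps <= 1, 0 < C,
      (forall x y : 'rV[R]_n, x != y ->
         cmod (K x y) <= C / enorm (x - y) ^+ n),
      (forall x x' y : 'rV[R]_n, 2 * enorm (x - x') < enorm (x - y) ->
         cmod (K x y - K x' y)
           <= C * powR (enorm (x - x')) eps / powR (enorm (x - y)) (n%:R + eps)) &
      (forall x y y' : 'rV[R]_n, 2 * enorm (y - y') < enorm (x - y) ->
         cmod (K x y - K x y')
           <= C * powR (enorm (y - y')) eps / powR (enorm (x - y)) (n%:R + eps))].

Definition CZ_operator (R : realType) (n : nat)
  (T : ('rV[R]_n -> R[i]) -> ('rV[R]_n -> R[i])) : Prop :=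
  [/\
      (forall f, schwartz f -> borel_cfun (T f)),
      (forall (a : R[i]) (f g : 'rV[R]_n -> R[i]), schwartz f -> schwartz g ->
         T (fun x => a * f x + g x) = (fun x => a * T f x + T g x)),
      (exists B : R, forall f, schwartz f -> (L2sq (T f) <= (B ^+ 2)%:E * L2sq f)%E) &
      (* the distributional kernel coincides with K off the diagonal *)
      exists (K : 'rV[R]_n -> 'rV[R]_n -> R[i]) (eps C : R),
        CZ_kernel K eps C /\
        forall f g : 'rV[R]_n -> R[i], test_fun f -> test_fun g ->
          supp f `&` supp g = set0 ->
          cint (fun x => T f x * g x) =
          cint (fun x => cint (fun y => K x y * f y) * g x)].

Definition stft (R : realType) (n : nat) (gamma f : 'rV[R]_n -> R[i])
  (x xi : 'rV[R]_n) : R[i] :=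
  cint (fun t => f t * conjc (expi (dotRn xi t) * gamma (t - x))).

Definition modnorm (R : realType) (n : nat) (gamma : 'rV[R]_n -> R[i]) (p q : R)
  (f : 'rV[R]_n -> R[i]) : \bar R :=
  (poweR (intRn (fun xi : 'rV[R]_n =>
            poweR (poweR (intRn (fun x => (powR (cmod (stft gamma f x xi)) p)%:E))
                         p^-1) q))
         q^-1)%E.

(* Main.v *)
Require Import Defs.
From mathcomp Require Import all_boot all_order all_algebra.
From mathcomp Require Import all_classical all_reals all_analysis.
From mathcomp Require Import measurable_realfun complex.
From mathcomp Require Import ring lra.
Import Num.Theory GRing.Theory.
Import Order.TTheory numFieldNormedType.Exports.

Set Implicit Arguments.
Unset Strict Implicit.
Unset Printing Implicit Defensive.

Local Open Scope classical_set_scope.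
Local Open Scope ring_scope.

(* Let [u] be a bounded continuous function of one real variable.  Multiplication by
   [u (t 0 0)] is bounded on L^2, and its kernel vanishes off the diagonal, so it is a
   Calderon-Zygmund operator; the point is to choose [u] so that it is unbounded on M^{p,q}.

   The window [gamma] has a short-time Fourier transform concentrated near the origin, and
   multiplication by [expi (lam * t 0 0)] translates it by [lam] in frequency.  A trigonometric
   polynomial [Q] with [N] widely separated frequencies and coefficients of modulus about
   N^{-1/2} therefore gives a product [Q gamma] whose M^{p,q} norm is about N^{1/q - 1/2},
   while Rudin-Shapiro signs keep [Q] bounded by [1].
   - If [q < 2], multiplication by [Q] sends [gamma] to a function of large norm.
   - If [q > 2], the function [conj Q * gamma] has small norm, and multiplication by [Q] sends
     it back to [|Q|^2 gamma], that is [gamma / 2] plus terms at high frequencies.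
   Both effects survive a small uniform perturbation of [Q] and the addition of polynomials
   whose frequencies are far from those of [Q], so a gliding hump argument sums such
   polynomials to a single [u] for which the operator norm exceeds every integer.

   The concentration estimates come from the oscillation of the character: translating by half
   a period bounds an integral against it by a finite difference of the integrand, and in
   several variables one uses mixed finite differences, which the mean value theorem bounds
   by mixed partial derivatives. *)

Section ComplexModulus.
Context {R : realType}.
Implicit Types (z w : R[i]) (t x : R).
Local Open Scope complex_scope.

Lemma ReM z w :
  complex.Re (z * w) = complex.Re z * complex.Re w - complex.Im z * complex.Im w.
Proof. by case: z; case: w. Qed.

Lemma ImM z w :
  complex.Im (z * w) = complex.Re z * complex.Im w + complex.Im z * complex.Re w.
Proof. by case: z; case: w. Qed.

Lemma cmod_normc z : cmod z = ComplexField.Normc.normc z.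
Proof. by case: z. Qed.

Lemma cmodM z w : cmod (z * w) = cmod z * cmod w.
Proof. by rewrite !cmod_normc ComplexField.Normc.normcM. Qed.

Lemma cmodN z : cmod (- z) = cmod z.
Proof. by rewrite !cmod_normc normcN. Qed.

Lemma cmod0 : cmod (0 : R[i]) = 0.
Proof. by rewrite cmod_normc ComplexField.Normc.normc0. Qed.

Lemma cmod_ge0 z : 0 <= cmod z.
Proof. exact: sqrtr_ge0. Qed.

Lemma cmod_gt0 z : z != 0 -> 0 < cmod z.
Proof.
move=> z0; rewrite lt_neqAle cmod_ge0 andbT eq_sym; apply: contra z0 => /eqP.
by rewrite cmod_normc => /ComplexField.Normc.eq0_normc ->.
Qed.

Lemma ler_cmodD z w : cmod (z + w) <= cmod z + cmod w.
Proof. by rewrite !cmod_normc le_normcD. Qed.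

Lemma lerB_cmodD z w : cmod z - cmod w <= cmod (z + w).
Proof. by rewrite lerBlDr -{1}(addrK w z) -(cmodN w) ler_cmodD. Qed.

Lemma ler_cmod_sum (I : Type) (r : seq I) (F : I -> R[i]) :
  cmod (\sum_(i <- r) F i) <= \sum_(i <- r) cmod (F i).
Proof.
elim/big_ind2: _ => [|z a w b za wb|//]; first by rewrite cmod0.
by rewrite (le_trans (ler_cmodD _ _)) // lerD.
Qed.

Lemma cmod_conjc z : cmod (conjc z) = cmod z.
Proof. by case: z => a b; rewrite /cmod /= sqrrN. Qed.

Lemma cmod_real x : cmod x%:C = `|x|.
Proof. by rewrite /cmod /= expr0n addr0 sqrtr_sqr. Qed.

Lemma sqr_cmod z : cmod z ^+ 2 = complex.Re z ^+ 2 + complex.Im z ^+ 2.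
Proof. by rewrite sqr_sqrtr // addr_ge0 ?sqr_ge0. Qed.

Lemma parallelogram z w :
  cmod (z + w) ^+ 2 + cmod (z - w) ^+ 2 = 2 * (cmod z ^+ 2 + cmod w ^+ 2).
Proof. by rewrite !sqr_cmod !(raddfD, raddfB); ring. Qed.

Lemma normr_Re_le z : `|complex.Re z| <= cmod z.
Proof. by rewrite -sqrtr_sqr ler_wsqrtr // lerDl sqr_ge0. Qed.

Lemma normr_Im_le z : `|complex.Im z| <= cmod z.
Proof. by rewrite -sqrtr_sqr ler_wsqrtr // lerDr sqr_ge0. Qed.

Lemma cmod_le_Re_Im z : cmod z <= `|complex.Re z| + `|complex.Im z|.
Proof.
rewrite {1}(complexE z) (le_trans (ler_cmodD _ _)) // cmodM !cmod_real.
by rewrite [X in X * _]/cmod /= expr0n expr1n add0r sqrtr1 mul1r.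
Qed.

Lemma expiD t x : expi (t + x) = expi t * expi x.
Proof.
rewrite /expi cosD sinD; apply/eqP; rewrite eq_complex /= eqxx /=.
by rewrite addrC (mulrC (sin t)).
Qed.

Lemma expi0 : expi (0 : R) = 1.
Proof. by rewrite /expi cos0 sin0. Qed.

Lemma expi_pi : expi (pi : R) = -1.
Proof. by rewrite /expi cospi sinpi; apply/eqP; rewrite eq_complex /= oppr0 !eqxx. Qed.

Lemma conjc_expi t : conjc (expi t) = expi (- t).
Proof. by rewrite /expi /= cosN sinN. Qed.

Lemma cmod_expi t : cmod (expi t) = 1.
Proof. by rewrite /cmod /= cos2Dsin2 sqrtr1. Qed.

End ComplexModulus.

Section TrigonometricPolynomials.
Context {R : realType}.
Implicit Types (S : seq (R[i] * R)) (b : R[i] * R) (L D r : R).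
Local Open Scope complex_scope.

Definition trig S r : R[i] := \sum_(b <- S) b.1 * expi (b.2 * r).

Definition l1norm S : R := \sum_(b <- S) cmod b.1.

Definition trig_mul S1 S2 : seq (R[i] * R) :=
  [seq (b1.1 * b2.1, b1.2 + b2.2) | b1 <- S1, b2 <- S2].

Lemma trig_nil r : trig [::] r = 0.
Proof. exact: big_nil. Qed.

Lemma trig_cons b S r : trig (b :: S) r = b.1 * expi (b.2 * r) + trig S r.
Proof. exact: big_cons. Qed.

Lemma trig_cat S1 S2 r : trig (S1 ++ S2) r = trig S1 r + trig S2 r.
Proof. exact: big_cat. Qed.

Lemma trigM S1 S2 r : trig (trig_mul S1 S2) r = trig S1 r * trig S2 r.
Proof.
rewrite /trig big_allpairs_dep mulr_suml; apply: eq_bigr => b1 _.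
by rewrite mulr_sumr; apply: eq_bigr => b2 _; rewrite mulrDl expiD mulrACA.
Qed.

Lemma l1norm_ge0 S : 0 <= l1norm S.
Proof. by apply: sumr_ge0 => b _; exact: cmod_ge0. Qed.

Lemma l1norm_cat S1 S2 : l1norm (S1 ++ S2) = l1norm S1 + l1norm S2.
Proof. exact: big_cat. Qed.

Lemma l1norm_filter (p : pred (R[i] * R)) S : l1norm [seq b <- S | p b] <= l1norm S.
Proof.
rewrite /l1norm big_filter [leRHS](bigID p) /= lerDl.
by apply: sumr_ge0 => b _; exact: cmod_ge0.
Qed.

Lemma l1normM S1 S2 : l1norm (trig_mul S1 S2) = l1norm S1 * l1norm S2.
Proof.
rewrite /l1norm big_allpairs_dep mulr_suml; apply: eq_bigr => b1 _.
by rewrite mulr_sumr; apply: eq_bigr => b2 _; rewrite cmodM.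
Qed.

Lemma l1norm_const (a : R) S : {in S, forall b, cmod b.1 = a} ->
  l1norm S = (size S)%:R * a.
Proof.
move=> Sa; rewrite /l1norm (eq_big_seq _ Sa) big_const_seq count_predT.
by rewrite iter_addr_0 mulr_natl.
Qed.

Lemma cmod_trig_le S r : cmod (trig S r) <= l1norm S.
Proof.
apply: le_trans (ler_cmod_sum _ _) _.
by apply: ler_sum => b _; rewrite cmodM cmod_expi mulr1.
Qed.

Definition freq_bound S : R := \sum_(b <- S) `|b.2|.

Lemma freq_bound_ge0 S : 0 <= freq_bound S.
Proof. exact: sumr_ge0. Qed.

Lemma le_freq_bound S b : b \in S -> `|b.2| <= freq_bound S.
Proof. by move=> bS; rewrite /freq_bound (big_rem b) //= lerDl sumr_ge0. Qed.

Definition isolated D b S := forall b', b' \in S -> D <= `|b.2 - b'.2|.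

Lemma isolated_le D D' b S : D <= D' -> isolated D' b S -> isolated D b S.
Proof. by move=> DD' iso b' /iso; exact: le_trans. Qed.

Lemma isolated_cat D b S1 S2 : isolated D b S1 -> isolated D b S2 -> isolated D b (S1 ++ S2).
Proof. by move=> iso1 iso2 b'; rewrite mem_cat => /orP[/iso1|/iso2]. Qed.

Lemma isolated_large D L b S : L <= `|b.2| -> D + freq_bound S <= L -> isolated D b S.
Proof.
move=> bL DL b' /le_freq_bound b'S; have := lerB_dist b.2 b'.2; lra.
Qed.

Lemma isolated_trig_mul D L (z : R[i]) S1 S2 : {in S2, forall b, L <= `|b.2|} ->
  D + freq_bound S1 <= L -> isolated D (z, 0) (trig_mul S1 S2).
Proof.
move=> S2L DL _ /allpairsP[[b1 b2] /= [/le_freq_bound b1S /S2L b2L ->]] /=.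
by rewrite sub0r normrN addrC; have := lerB_normD b2.2 b1.2; lra.
Qed.

Definition separated D S := {in S, forall b, isolated D b (rem b S)}.

Lemma separated_freq_neq D S : separated D S ->
  {in S &, forall b b', b.2 != b'.2 -> D <= `|b.2 - b'.2|}.
Proof.
move=> sep b b' bS b'S bb'; apply: sep => //.
have : b' \in b :: rem b S by rewrite -(perm_mem (perm_to_rem bS)).
by rewrite inE => /orP[/eqP E|//]; rewrite E eqxx in bb'.
Qed.

Lemma separated_uniq D S : 0 < D -> separated D S -> uniq [seq b.2 | b <- S].
Proof.
move=> D0; elim: S => [//|b S IH] sep /=; apply/andP; split.
  apply/negP => /mapP[b' b'S E]; have := sep b (mem_head _ _) b'.
  by rewrite /= eqxx b'S E subrr normr0 leNgt D0 => /(_ isT).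
apply: IH => b' b'S b'' b''S; apply: sep; rewrite ?inE ?b'S ?orbT //=.
by case: eqVneq => [_|_]; [exact: mem_rem b''S|rewrite inE b''S orbT].
Qed.

End TrigonometricPolynomials.

Section RudinShapiro.
Context {R : realType}.
Implicit Types (es fs : seq R) (c kap L r : R).
Local Open Scope complex_scope.

Definition harmonics es L : seq (R[i] * R) :=
  [seq ((nth 0 es j)%:C, j.+1%:R * L) | j <- iota 0 (size es)].

Lemma trig_harmonics es L r : trig (harmonics es L) r =
  \sum_(j < size es) (nth 0 es j)%:C * expi (j.+1%:R * L * r).
Proof. by rewrite /trig big_map -[X in iota _ X]subn0 big_mkord. Qed.

Lemma trig_harmonics_cat es fs L r : trig (harmonics (es ++ fs) L) r =
  trig (harmonics es L) r + expi ((size es)%:R * L * r) * trig (harmonics fs L) r.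
Proof.
rewrite !trig_harmonics size_cat big_split_ord mulr_sumr /=; congr (_ + _).
  by apply: eq_bigr => j _; rewrite nth_cat ltn_ord.
apply: eq_bigr => j _; rewrite nth_cat ltnNge leq_addr /= addKn.
by rewrite mulrCA -expiD; congr (_ * expi _); rewrite -addnS natrD; ring.
Qed.

Lemma trig_harmonics_scale c es L r :
  trig (harmonics [seq c * e | e <- es] L) r = c%:C * trig (harmonics es L) r.
Proof.
rewrite !trig_harmonics size_map mulr_sumr; apply: eq_bigr => j _.
by rewrite (nth_map 0) // rmorphM mulrA.
Qed.

Lemma size_harmonics es L : size (harmonics es L) = size es.
Proof. by rewrite size_map size_iota. Qed.

Lemma cmod_harmonics c es L : {in es, forall e, `|e| = c} ->
  {in harmonics es L, forall b, cmod b.1 = c}.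
Proof.
by move=> ec _ /mapP[j + ->]; rewrite mem_iota /= cmod_real => je; rewrite ec ?mem_nth.
Qed.

Lemma ler_dist_multiples L (j k : nat) : j != k -> `|L| <= `|j%:R * L - k%:R * L|.
Proof.
rewrite -mulrBl normrM neq_ltn => jk; rewrite ler_peMl //.
wlog kj : j k jk / (k < j)%N => [dist_ge1|]; first by case/orP: jk => lt; [rewrite distrC|];
  apply: dist_ge1; rewrite // lt ?orbT.
by rewrite -natrB ?(ltnW kj) // ger0_norm ?ler1n ?subn_gt0.
Qed.

Lemma harmonics_freq_large es L b : b \in harmonics es L -> `|L| <= `|b.2|.
Proof. by case/mapP=> j _ -> /=; rewrite normrM ler_peMl // ger0_norm ?ler1n. Qed.

Lemma separated_harmonics es L : L != 0 -> separated `|L| (harmonics es L).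
Proof.
move=> L0 b bH b'; rewrite mem_rem_uniq; last first.
  rewrite map_inj_uniq ?iota_uniq // => j k [_ /(mulIf L0)/eqP].
  by rewrite eqr_nat => /eqP[].
case/andP=> + /mapP[k kI b'E]; case/mapP: bH => j jI bE; rewrite bE b'E /= => jk.
by apply: ler_dist_multiples; apply: contra jk => /eqP[->].
Qed.

Definition off_diagonal es fs L : seq (R[i] * R) :=
  [seq b <- trig_mul (harmonics es L) (harmonics fs (- L)) | b.2 != 0].

Lemma off_diagonal_freq_large es fs L b : b \in off_diagonal es fs L -> `|L| <= `|b.2|.
Proof.
rewrite mem_filter => /andP[b0 /allpairsP[[_ _] /= [/mapP[j _ ->] /mapP[k _ ->] bE]]].
move: b0; rewrite bE /= mulrN subr_eq0 => jk; apply: ler_dist_multiples.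
by apply: contra jk => /eqP ->.
Qed.

Lemma trig_harmonicsM es fs L r : L != 0 -> size es = size fs ->
  trig (harmonics es L) r * trig (harmonics fs (- L)) r =
  (\sum_(j < size es) nth 0 es j * nth 0 fs j)%:C + trig (off_diagonal es fs L) r.
Proof.
move=> L0 sz; rewrite -trigM /trig (bigID (fun b => b.2 == 0)) big_filter /=.
congr (_ + _); rewrite big_mkcond big_allpairs_dep big_map /= rmorph_sum.
rewrite -{1}[size es]subn0 big_mkord; apply: eq_bigr => j _.
rewrite big_map -sz -[X in iota _ X]subn0 big_mkord (bigD1 j) //=.
rewrite [in j.+1%:R * - L]mulrN subrr eqxx mul0r expi0 mulr1 -rmorphM big1 ?addr0 // => k kj.
by rewrite mulrN subr_eq0 (inj_eq (mulIf L0)) eqr_nat eqSS eq_sym (val_eqE k j) (negbTE kj).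
Qed.

Fixpoint rudin_shapiro_pair (a : nat) : seq R * seq R := match a with
  | 0 => ([:: 1], [:: 1])
  | a'.+1 => let (P, Q) := rudin_shapiro_pair a' in (P ++ Q, P ++ [seq -1 * e | e <- Q])
  end.

Definition rudin_shapiro (a : nat) : seq R := (rudin_shapiro_pair a).1.

Lemma size_rudin_shapiro_pair a :
  size (rudin_shapiro_pair a).1 = (2 ^ a)%N /\ size (rudin_shapiro_pair a).2 = (2 ^ a)%N.
Proof.
elim: a => [//|a] /=; case: (rudin_shapiro_pair a) => P Q /= [sizeP sizeQ].
by rewrite !size_cat size_map sizeP sizeQ addnn expnS mul2n.
Qed.

Lemma norm_rudin_shapiro_pair a :
  {in (rudin_shapiro_pair a).1, forall e, `|e| = 1} /\
  {in (rudin_shapiro_pair a).2, forall e, `|e| = 1}.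
Proof.
elim: a => [|a] /=; first by split=> e; rewrite inE => /eqP ->; rewrite normr1.
case: (rudin_shapiro_pair a) => P Q /= [P1 Q1].
split=> e; rewrite mem_cat => /orP[/P1 //|]; first exact: Q1.
by case/mapP=> e' /Q1 e'1 ->; rewrite mulN1r normrN.
Qed.

Lemma rudin_shapiro_pair_flat a L r :
  cmod (trig (harmonics (rudin_shapiro_pair a).1 L) r) ^+ 2 +
  cmod (trig (harmonics (rudin_shapiro_pair a).2 L) r) ^+ 2 = 2 ^+ a.+1.
Proof.
elim: a => [|a] /=.
  by rewrite trig_harmonics big_ord1 cmodM cmod_expi cmod_real normr1 mulr1 !expr1n.
have [sizeP sizeQ] := size_rudin_shapiro_pair a.
case: (rudin_shapiro_pair a) sizeP sizeQ => P Q /= sizeP sizeQ flat.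
rewrite !trig_harmonics_cat trig_harmonics_scale rmorphN1 mulN1r mulrN parallelogram.
by rewrite cmodM cmod_expi mul1r flat -exprS.
Qed.

Definition flat_scale (a : nat) : R := (Num.sqrt (2 ^+ a.+1))^-1.

Lemma flat_scale_gt0 a : 0 < flat_scale a.
Proof. by rewrite invr_gt0 sqrtr_gt0 exprn_gt0. Qed.

Lemma sqr_flat_scale a : flat_scale a ^+ 2 * 2 ^+ a = 2^-1.
Proof. by rewrite exprVn sqr_sqrtr ?exprn_ge0 // exprS invfM mulfVK // expf_neq0. Qed.

Definition flat_coefs kap a : seq R := [seq kap * flat_scale a * e | e <- rudin_shapiro a].

Lemma size_flat_coefs kap a : size (flat_coefs kap a) = (2 ^ a)%N.
Proof. by rewrite size_map (size_rudin_shapiro_pair a).1. Qed.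

Lemma norm_flat_coefs kap a : 0 <= kap ->
  {in flat_coefs kap a, forall e, `|e| = kap * flat_scale a}.
Proof.
move=> kap0 _ /mapP[e /(norm_rudin_shapiro_pair a).1 e1 ->].
by rewrite normrM e1 mulr1 ger0_norm // mulr_ge0 // ltW // flat_scale_gt0.
Qed.

Lemma cmod_trig_flat_le kap a L r : 0 <= kap ->
  cmod (trig (harmonics (flat_coefs kap a) L) r) <= kap.
Proof.
move=> kap0; have s0 := flat_scale_gt0 a.
rewrite trig_harmonics_scale cmodM cmod_real ger0_norm ?mulr_ge0 ?(ltW s0) //.
rewrite -mulrA ler_piMr // mulrC ler_pdivrMr ?sqrtr_gt0 ?exprn_gt0 // mul1r.
rewrite -[leLHS]ger0_norm ?cmod_ge0 // -sqrtr_sqr ler_wsqrtr //.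
by rewrite -(rudin_shapiro_pair_flat a L r) lerDl sqr_ge0.
Qed.

Lemma l1norm_flat kap a L : 0 <= kap ->
  l1norm (harmonics (flat_coefs kap a) L) = 2 ^+ a * (kap * flat_scale a).
Proof.
move=> kap0; rewrite (l1norm_const (cmod_harmonics (norm_flat_coefs kap0))).
by rewrite size_harmonics size_flat_coefs natrX.
Qed.

(* The conjugate of the flat polynomial with spacing [L] is the one with spacing [- L]. *)
Lemma trig_flatM kap a L r : L != 0 ->
  trig (harmonics (flat_coefs kap a) L) r * trig (harmonics (flat_coefs 1 a) (- L)) r =
  (kap / 2)%:C + trig (off_diagonal (flat_coefs kap a) (flat_coefs 1 a) L) r.
Proof.
move=> L0; rewrite trig_harmonicsM ?size_flat_coefs //; congr (_%:C + _).
rewrite (eq_bigr (fun=> kap * flat_scale a ^+ 2)) => [|j _].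
  by rewrite sumr_const card_ord -[LHS]mulr_natr natrX -(sqr_flat_scale a); ring.
have jlt : (j < size (rudin_shapiro a))%N by rewrite (size_rudin_shapiro_pair a).1.
rewrite !(nth_map 0) // mul1r mulrACA -!expr2.
have e1 := (norm_rudin_shapiro_pair a).1 _ (mem_nth 0 jlt).
by rewrite -[nth _ _ _ ^+ 2]real_normK ?num_real // e1 expr1n; ring.
Qed.

End RudinShapiro.

Section RealLineCalculus.
Context {R : realType}.
Implicit Types (f df : R -> R) (x h r C : R).

Lemma MVT_increment f df : (forall x, is_derive x 1 f (df x)) -> forall x h,
  exists2 th, `|th| <= `|h| & f (x + h) - f x = h * df (x + th).
Proof.
move=> fdf x h; have cf : continuous f.
  move=> y; have [d _] := fdf y.
  by apply: differentiable_continuous; apply/derivable1_diffP.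
have [h0|h0] := leP 0 h.
- have [||c] := @MVT_segment R f df x (x + h) _ (fun y _ => fdf y).
  + by rewrite lerDl.
  + exact: continuous_subspaceT.
  rewrite in_itv /= => /andP[xc ch] ->; exists (c - x); last by rewrite subrKC addrC addKr mulrC.
  by rewrite !ger0_norm ?subr_ge0 // lerBlDl.
- have [||c] := @MVT_segment R f df (x + h) x _ (fun y _ => fdf y).
  + by rewrite gerDl ltW.
  + exact: continuous_subspaceT.
  rewrite in_itv /= => /andP[hc cx] E; exists (c - x).
    by rewrite !ler0_norm ?subr_le0 ?(ltW h0) // lerN2 lerBrDl.
  by rewrite subrKC -opprB E; ring.
Qed.

Lemma locally_lipschitz_continuous f r C : 0 < r ->
  (forall x h, `|h| <= r -> `|f (x + h) - f x| <= C * `|h|) -> continuous f.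
Proof.
move=> r0 fC x; apply/cvgrPdist_le => e e0.
have C0 : 0 < `|C| + 1 by rewrite ltr_pwDr.
have d0 : 0 < Num.min r (e / (`|C| + 1)) by rewrite lt_min r0 divr_gt0.
near=> y.
have : `|y - x| <= Num.min r (e / (`|C| + 1)).
  by near: y; exact: (@cvgr_distC_le _ _ _ _ _ id x cvg_id _ d0).
rewrite le_min => /andP[yr]; rewrite ler_pdivlMr // => ye.
rewrite distrC -{1}(subrKC x y) (le_trans (fC _ _ yr)) // (le_trans _ ye) // mulrC.
by rewrite ler_wpM2l // (le_trans (ler_norm _)) // lerDl.
Unshelve. all: by end_near. Qed.

Lemma continuous_translate (f : R -> R) h : continuous f -> continuous (fun x => f (x + h)).
Proof.
move=> cf x; apply: (@continuous_comp _ _ _ (+%R^~ h) f); last exact: cf.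
by apply: cvgD; [exact: cvg_id|exact: cvg_cst].
Qed.

Lemma cmod_expi_sub1_le x : cmod (expi x - 1) <= 2 * `|x|.
Proof.
rewrite (le_trans (cmod_le_Re_Im _)) // mulr_natl mulr2n raddfB raddfB /= subr0; apply: lerD.
- have [th _] := @MVT_increment cos _ (@is_derive_cos R) 0 x.
  by rewrite !add0r cos0 => ->; rewrite normrM normrN ler_piMr // sin_max.
- have [th _] := @MVT_increment sin _ (@is_derive_sin R) 0 x.
  by rewrite !add0r sin0 subr0 => ->; rewrite normrM ler_piMr // cos_max.
Qed.

End RealLineCalculus.

Section Decay.
Context {R : realType}.
Implicit Types (x y h s : R) (k l : nat).

Definition decay k x : R := ((1 + `|x|) ^+ k)^-1.

Lemma onep_normr_gt0 x : 0 < 1 + `|x|.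
Proof. by rewrite ltr_pwDl. Qed.

Lemma decay_gt0 k x : 0 < decay k x.
Proof. by rewrite invr_gt0 exprn_gt0 // onep_normr_gt0. Qed.

Lemma decay_ge0 k x : 0 <= decay k x.
Proof. exact: ltW (decay_gt0 _ _). Qed.

Lemma decay_le1 k x : decay k x <= 1.
Proof. by rewrite invf_le1 ?exprn_ege1 ?lerDl // exprn_gt0 // onep_normr_gt0. Qed.

Lemma decayD k l x : decay (k + l) x = decay k x * decay l x.
Proof. by rewrite /decay exprD invfM. Qed.

Lemma decay1_mul x : decay 1 x * (1 + `|x|) = 1.
Proof. by rewrite /decay expr1 mulVf // gt_eqF // onep_normr_gt0. Qed.

Lemma decay1_le D x : 0 < D -> D <= `|x| -> decay 1 x <= D^-1.
Proof.
by move=> D0 Dx; rewrite /decay expr1 lef_pV2 ?posrE ?onep_normr_gt0 // (le_trans Dx) // lerDr.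
Qed.

Lemma decay_continuous k : continuous (decay k).
Proof.
move=> x; apply: cvgV; first by rewrite expf_neq0 // gt_eqF // onep_normr_gt0.
apply: (@continuous_comp _ _ _ (fun y : R => 1 + `|y|) (fun z => z ^+ k)); last first.
  exact: exprn_continuous.
by apply: cvgD; [exact: cvg_cst|exact: norm_continuous].
Qed.

Lemma decay_powR k s x : decay k x `^ s = (1 + `|x|) `^ (- (k%:R * s)).
Proof.
by rewrite -mulNr powRrM powR_invn ?(ltW (onep_normr_gt0 x)).
Qed.

Lemma decay_powR_continuous k s : continuous (fun x => decay k x `^ s).
Proof.
move=> x; apply: (@continuous_comp _ _ _ (decay k) (@powR R ^~ s)).
  exact: decay_continuous.
apply: differentiable_continuous; apply/derivable1_diffP.
by apply: derivable_powR; rewrite in_itv /= andbT decay_gt0.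
Qed.

Lemma peetre_decay k x y : decay k x * decay k (x - y) <= decay k y.
Proof.
rewrite -invfM -exprMn lef_pV2 ?posrE ?exprn_gt0 ?mulr_gt0 ?onep_normr_gt0 //.
apply: lerXn2r; rewrite ?nnegrE ?mulr_ge0 ?addr_ge0 //.
have : `|y| <= `|x| + `|x - y| by rewrite -{1}(subKr x y) ler_normB.
have : 0 <= `|x| * `|x - y| by rewrite mulr_ge0.
lra.
Qed.

Lemma decay_translate k x h : decay k (x + h) <= (decay k h)^-1 * decay k x.
Proof.
rewrite ler_pdivlMl ?decay_gt0 // mulrC.
by have := peetre_decay k (x + h) x; rewrite (addrC x h) addrK.
Qed.

Lemma decay_translate_le k r x h : `|h| <= r -> decay k (x + h) <= (1 + r) ^+ k * decay k x.
Proof.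
move=> hr; rewrite (le_trans (decay_translate _ _ _)) // invrK ler_wpM2r ?decay_ge0 //.
by rewrite lerXn2r ?nnegrE ?addr_ge0 ?lerD2l // (le_trans _ hr).
Qed.

Lemma prod_decay_ge0 (I : Type) (r : seq I) k (F : I -> R) :
  0 <= \prod_(i <- r) decay k (F i).
Proof. by apply: prodr_ge0 => i _; exact: decay_ge0. Qed.

Lemma prod_decay_le1 (I : Type) (r : seq I) k (F : I -> R) :
  \prod_(i <- r) decay k (F i) <= 1.
Proof.
by apply: prodr_ile1 => i _; rewrite decay_ge0 decay_le1.
Qed.

Lemma is_derive_onep_powR s x : 0 <= x ->
  is_derive x 1 (fun y => (1 + y) `^ s) (s * (1 + x) `^ (s - 1)).
Proof.
move=> x0; have x1 : 0 < 1 + x by rewrite ltr_pwDl.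
have d1 : is_derive x 1 (+%R 1) (1 : R).
  by rewrite -[X in is_derive _ _ _ X]add0r; exact: is_deriveD.
by have := is_derive1_comp (is_derive1_powR s x1) d1; rewrite mulr1.
Qed.

Lemma cvg_onep_powR_pinfty s : s < 0 -> (1 + x) `^ s @[x --> +oo] --> 0.
Proof.
rewrite -oppr_gt0 => s0; apply/cvgr0Pnorm_le => e e0; near=> x.
have x0 : 0 < 1 + x by rewrite ltr_pwDl //; near: x; exact: nbhs_pinfty_ge.
rewrite ger0_norm ?powR_ge0 // -[s]opprK powRN -[leRHS]invrK.
rewrite lef_pV2 ?posrE ?powR_gt0 ?invr_gt0 //.
have -> : e^-1 = (e^-1 `^ (- s)^-1) `^ (- s).
  by rewrite -powRrM mulVf ?gt_eqF // powRr1 // invr_ge0 ltW.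
rewrite ge0_ler_powR ?nnegrE ?powR_ge0 // ?ltW //.
by rewrite (@le_lt_trans _ _ x) ?ltrDr //; near: x; exact: nbhs_pinfty_ge.
Unshelve. all: by end_near. Qed.

Let mu := @lebesgue_measure R.

Lemma integral_onep_normr_powR s : 1 < s ->
  (\int[mu]_x ((1 + `|x|) `^ (- s))%:E = (2 / (s - 1))%:E)%E.
Proof.
move=> s1; have s10 : 1 - s != 0 by rewrite lt_eqF // subr_lt0.
have c1 : continuous (fun x : R => (1 + `|x|) `^ (- s)).
  by have := @decay_powR_continuous 1 s; under eq_fun do rewrite decay_powR mul1r.
have p0 (x : R) : 0 <= (1 + `|x|) `^ (- s) by exact: powR_ge0.
rewrite (ge0_symfun_integralT p0 c1); last by move=> x /=; rewrite normrN.
have -> : [set x : R | 0 <= x] = `[0, +oo[%classic.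
  by apply/seteqP; split => x /=; rewrite in_itv /= andbT.
pose F (x : R) := (1 - s)^-1 * (1 + x) `^ (1 - s).
have dF (x : R) : 0 <= x -> is_derive x 1 F ((1 + x) `^ (- s)).
  move=> x0; have := is_deriveZ (1 - s)^-1 (is_derive_onep_powR (1 - s) x0).
  by rewrite /GRing.scale /= mulKf // addrAC subrr add0r.
rewrite (@ge0_continuous_FTC2y R _ F 0 0).
- rewrite sub0e -EFinN -EFinM /F addr0 powR1 mulr1; congr EFin.
  by field; rewrite s10 gt_eqF // subr_gt0.
- by move=> x _; exact: p0.
- exact: continuous_subspaceT.
- rewrite -(mulr0 (1 - s)^-1); apply: cvgMl_tmp.
  by apply: cvg_onep_powR_pinfty; rewrite subr_lt0.
- by move=> x /ltW /dF [].
- have [d0 _] := dF 0 (lexx _); apply: cvg_at_right_filter.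
  by apply: differentiable_continuous; apply/derivable1_diffP.
- move=> x; rewrite in_itv /= andbT => x0; rewrite derive1E.
  by rewrite (@derive_val _ _ _ _ _ _ _ (dF x (ltW x0))) gtr0_norm.
Qed.

Lemma integral_decay1_powR s : 1 < s ->
  (\int[mu]_x (decay 1 x `^ s)%:E = (2 / (s - 1))%:E)%E.
Proof.
by move=> s1; under eq_integral do rewrite decay_powR mul1r;
  exact: integral_onep_normr_powR.
Qed.

Lemma integral_decay2 : (\int[mu]_x (decay 2 x)%:E = 2%:E)%E.
Proof.
under eq_integral do rewrite -[decay 2 _]powRr1 ?decay_ge0 // decay_powR mulr1.
by rewrite integral_onep_normr_powR ?ltr1n //; congr EFin; field.
Qed.

End Decay.

Section ComplexIntegral.
Context {R : realType}.
Let mu := @lebesgue_measure R.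
Implicit Types (f : R -> R) (B u v : R -> R[i]) (c C h xi : R) (a : R[i]).
Local Open Scope complex_scope.

Definition ccontinuous u :=
  continuous (fun x => complex.Re (u x)) /\ continuous (fun x => complex.Im (u x)).

Lemma ccontinuousM u v : ccontinuous u -> ccontinuous v -> ccontinuous (fun x => u x * v x).
Proof.
move=> [ur ui] [vr vi]; split=> x.
- under eq_fun do rewrite ReM.
  by apply: cvgB; apply: cvgM; [exact: ur|exact: vr|exact: ui|exact: vi].
- under eq_fun do rewrite ImM.
  by apply: cvgD; apply: cvgM; [exact: ur|exact: vi|exact: ui|exact: vr].
Qed.

Lemma ccontinuousD u v : ccontinuous u -> ccontinuous v -> ccontinuous (fun x => u x + v x).
Proof.
move=> [ur ui] [vr vi]; split=> x.
- by under eq_fun do rewrite raddfD; apply: cvgD; [exact: ur|exact: vr].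
- by under eq_fun do rewrite raddfD; apply: cvgD; [exact: ui|exact: vi].
Qed.

Lemma ccontinuous_cst a : ccontinuous (fun=> a).
Proof. by split=> x; exact: cvg_cst. Qed.

Lemma ccontinuousB u v : ccontinuous u -> ccontinuous v -> ccontinuous (fun x => u x - v x).
Proof.
move=> cu cv; under eq_fun do rewrite -mulN1r.
exact: ccontinuousD cu (ccontinuousM (ccontinuous_cst _) cv).
Qed.

Lemma ccontinuous_translate u h : ccontinuous u -> ccontinuous (fun x => u (x + h)).
Proof.
by move=> [r i]; split; [exact: (continuous_translate r)|exact: (continuous_translate i)].
Qed.

Lemma ccontinuous_expi c : ccontinuous (fun x => expi (c * x)).
Proof.
have cM : continuous (fun x : R => c * x).
  by move=> x; apply: cvgM; [exact: cvg_cst|exact: cvg_id].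
split=> x; apply: (continuous_comp (cM x)); [exact: continuous_cos|exact: continuous_sin].
Qed.

Lemma ccontinuous_trig S : ccontinuous (trig S).
Proof.
rewrite (_ : trig S = fun r => trig S r) //; elim: S => [|b S IH].
  by under eq_fun do rewrite trig_nil; exact: ccontinuous_cst.
under eq_fun do rewrite trig_cons; apply: ccontinuousD IH.
exact: ccontinuousM (ccontinuous_cst _) (ccontinuous_expi _).
Qed.

Definition cintegrable B :=
  mu.-integrable setT (EFin \o (fun x => complex.Re (B x))) /\
  mu.-integrable setT (EFin \o (fun x => complex.Im (B x))).

Definition cintegral B : R[i] :=
  Complex (Rintegral mu setT (fun x => complex.Re (B x)))
          (Rintegral mu setT (fun x => complex.Im (B x))).

Lemma cintegrableD u v : cintegrable u -> cintegrable v -> cintegrable (fun x => u x + v x).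
Proof.
move=> [ur ui] [vr vi]; split.
- by apply: eq_integrable (integrableD _ ur vr) => // x _ /=; rewrite raddfD.
- by apply: eq_integrable (integrableD _ ui vi) => // x _ /=; rewrite raddfD.
Qed.

Lemma integrable_EFinZl c f : mu.-integrable setT (EFin \o f) ->
  mu.-integrable setT (EFin \o (fun x => c * f x)).
Proof. by move=> fi; apply: eq_integrable (integrableZl measurableT c fi). Qed.

Lemma cintegrableZ a u : cintegrable u -> cintegrable (fun x => a * u x).
Proof.
move=> [ur ui]; split.
- apply: eq_integrable (integrableB measurableT (integrable_EFinZl (complex.Re a) ur)
    (integrable_EFinZl (complex.Im a) ui)) => // x _ /=; by rewrite ReM.
- apply: eq_integrable (integrableD measurableT (integrable_EFinZl (complex.Re a) ui)
    (integrable_EFinZl (complex.Im a) ur)) => // x _ /=; by rewrite ImM.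
Qed.

Lemma cintegralD u v : cintegrable u -> cintegrable v ->
  cintegral (fun x => u x + v x) = cintegral u + cintegral v.
Proof.
move=> [ur ui] [vr vi]; congr Complex.
- by under eq_Rintegral do rewrite raddfD; exact: RintegralD.
- by under eq_Rintegral do rewrite raddfD; exact: RintegralD.
Qed.

Lemma cintegralZ a u : cintegrable u -> cintegral (fun x => a * u x) = a * cintegral u.
Proof.
move=> [ur ui]; case: a => c d; congr Complex => /=.
- under eq_Rintegral do rewrite ReM.
  by rewrite RintegralB ?RintegralZl //; exact: integrable_EFinZl.
- under eq_Rintegral do rewrite ImM.
  by rewrite RintegralD ?RintegralZl //; exact: integrable_EFinZl.
Qed.

Lemma cintegralB u v : cintegrable u -> cintegrable v ->
  cintegral (fun x => u x - v x) = cintegral u - cintegral v.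
Proof.
move=> ui vi; under eq_fun do rewrite -mulN1r.
by rewrite cintegralD ?cintegralZ ?mulN1r //; exact: cintegrableZ.
Qed.

Lemma ge0_integral_translate f h : continuous f -> (forall x, 0 <= f x) ->
  (\int[mu]_x (f (x + h))%:E = \int[mu]_x (f x)%:E)%E.
Proof.
move=> cf f0; have d1 : derive1 (+%R^~ h : R -> R) = cst 1.
  apply/funext => x; rewrite derive1E.
  by have [_ ->] : is_derive x 1 (+%R^~ h : R -> R) 1 by apply: is_derive_eq; rewrite addr0.
rewrite [RHS](@increasing_ge0_integration_by_substitutionT R (+%R^~ h)) //.
- by apply: eq_integral => x _; rewrite d1 /= /GRing.mul /= mulr1.
- by move=> x y; rewrite ltrD2r.
- by rewrite d1 => x; exact: cvg_cst.
- by rewrite d1; exact: is_cvg_cst.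
- by rewrite d1; exact: is_cvg_cst.
- apply/cvgrNyPle => A; near=> x; rewrite -lerBrDr; near: x.
  by apply: nbhs_ninfty_le; exact: num_real.
- apply/cvgryPge => A; near=> x; rewrite -lerBlDr; near: x.
  by apply: nbhs_pinfty_ge; exact: num_real.
Unshelve. all: by end_near. Qed.

Lemma integral_translate f h : continuous f ->
  (\int[mu]_x (f (x + h))%:E = \int[mu]_x (f x)%:E)%E.
Proof.
move=> cf; rewrite integralE [RHS]integralE.
rewrite (funepos_comp (EFin \o f) (+%R^~ h)) (funeneg_comp (EFin \o f) (+%R^~ h)).
rewrite funerpos funerneg; congr (_ - _)%E; apply: ge0_integral_translate => // x.
- exact: (continuous_max (f := f) (g := cst 0) (cf x) (cvg_cst _)).
- exact: (continuous_max (f := \- f) (g := cst 0) (cvgN (cf x)) (cvg_cst _)).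
Qed.

Lemma cintegral_translate B h : ccontinuous B -> cintegral (fun x => B (x + h)) = cintegral B.
Proof.
move=> [r i]; congr Complex; rewrite /Rintegral.
- by rewrite (integral_translate h r).
- by rewrite (integral_translate h i).
Qed.

Definition cdecay B := ccontinuous B /\ exists C, forall x, cmod (B x) <= C * decay 2 x.

Lemma integrable_decay2 : mu.-integrable setT (EFin \o (decay 2 : R -> R)).
Proof.
apply/integrableP; split.
  by apply/measurable_EFinP; apply: continuous_measurable_fun; exact: decay_continuous.
by under eq_integral do rewrite /= ger0_norm ?decay_ge0 //; rewrite integral_decay2 ltry.
Qed.

Lemma cdecay_integrable B : cdecay B -> cintegrable B.
Proof.
move=> [[r i] [C BC]]; split;
  apply: le_integrable (integrable_EFinZl C integrable_decay2) => //.
- by apply/measurable_EFinP; exact: continuous_measurable_fun.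
- move=> x _ /=; rewrite lee_fin (le_trans (normr_Re_le _)) //.
  by rewrite (le_trans (BC x)) // ler_norm.
- by apply/measurable_EFinP; exact: continuous_measurable_fun.
- move=> x _ /=; rewrite lee_fin (le_trans (normr_Im_le _)) //.
  by rewrite (le_trans (BC x)) // ler_norm.
Qed.

Lemma cdecayM u c B : ccontinuous u -> (forall x, cmod (u x) <= c) -> cdecay B ->
  cdecay (fun x => u x * B x).
Proof.
move=> cu uc [cB [C BC]]; split; first exact: ccontinuousM.
by exists (c * C) => x; rewrite cmodM -mulrA ler_pM ?cmod_ge0.
Qed.

Lemma cdecay_expiM xi B : cdecay B -> cdecay (fun x => expi (xi * x) * B x).
Proof. by apply: (@cdecayM _ 1) => [|x]; [exact: ccontinuous_expi|rewrite cmod_expi]. Qed.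

Lemma ge0_le_decay C B : (forall x, cmod (B x) <= C * decay 2 x) -> 0 <= C.
Proof.
by move=> /(_ 0)/(le_trans (cmod_ge0 _)); rewrite pmulr_lge0 // decay_gt0.
Qed.

Lemma cdecay_translate B h : cdecay B -> cdecay (fun x => B (x + h)).
Proof.
move=> [cB [C BC]]; split; first exact: ccontinuous_translate.
exists (C * (decay 2 h)^-1) => x.
by rewrite -mulrA (le_trans (BC _)) // ler_wpM2l ?decay_translate // (ge0_le_decay BC).
Qed.

Lemma cmod_cintegral_le B C : cintegrable B -> (forall x, cmod (B x) <= C * decay 2 x) ->
  cmod (cintegral B) <= 4 * C.
Proof.
move=> [r i] BC; have bound (f : R -> R) : mu.-integrable setT (EFin \o f) ->
    (forall x, `|f x| <= cmod (B x)) -> `|Rintegral mu setT f| <= C * 2.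
  move=> fi fB; rewrite (le_trans (le_normr_Rintegral _ fi)) //.
  rewrite (_ : C * 2 = Rintegral mu setT (fun x => C * decay 2 x)).
    apply: le_Rintegral; [exact: measurableT|exact: (integrable_norm fi)|
      exact: (integrable_EFinZl C integrable_decay2)|].
    by move=> x _; exact: le_trans (fB x) (BC x).
  by rewrite RintegralZl ?integrable_decay2 // /Rintegral integral_decay2.
rewrite (le_trans (cmod_le_Re_Im _)) // (_ : 4 * C = C * 2 + C * 2); last by ring.
apply: lerD.
- exact: (bound _ r (fun x => normr_Re_le (B x))).
- exact: (bound _ i (fun x => normr_Im_le (B x))).
Qed.

(* The oscillation argument translates by [pi / xi] with [1 <= `|xi|], hence the range of
   the increments. *)
Definition lipschitz_decay C B := (forall x, cmod (B x) <= C * decay 2 x) /\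
  (forall x h, `|h| <= pi -> cmod (B (x + h) - B x) <= C * `|h| * decay 2 x).

Lemma lipschitz_decay_cdecay C B : lipschitz_decay C B -> cdecay B.
Proof.
move=> [BC dBC]; have C0 := ge0_le_decay BC; split; last by exists C.
have {}dBC x h : `|h| <= pi -> cmod (B (x + h) - B x) <= C * `|h|.
  by move=> hpi; rewrite (le_trans (dBC x h hpi)) // ler_piMr ?decay_le1 ?mulr_ge0.
split; apply: (@locally_lipschitz_continuous _ _ _ C (pi_gt0 R)) => x h hpi;
  rewrite -raddfB (le_trans _ (dBC x h hpi)) //.
- exact: normr_Re_le.
- exact: normr_Im_le.
Qed.

(* Translating the integrand by half a period of the character changes the sign of the
   character, so the integral only sees a difference of [B]. *)
Lemma cintegral_expi_half_period B xi : cdecay B -> xi != 0 ->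
  2%:C * cintegral (fun x => expi (- xi * x) * B x) =
  - cintegral (fun x => expi (- xi * x) * (B (x + pi / xi) - B x)).
Proof.
move=> dB xi0; set h := pi / xi; set e := fun x => expi (- xi * x).
have eh x : e (x + h) = - e x.
  rewrite /e (_ : - xi * (x + h) = - xi * x + - pi); last by rewrite /h; field.
  by rewrite expiD -conjc_expi expi_pi rmorphN1 mulrN1.
have deB := cdecay_expiM (- xi) dB.
have -> : (fun x => e x * (B (x + h) - B x)) =
    (fun x => -1 * (e (x + h) * B (x + h)) - e x * B x).
  by apply/funext => x; rewrite eh; ring.
have deBh : cdecay (fun x => e (x + h) * B (x + h)) := cdecay_translate h deB.
rewrite cintegralB ?cintegralZ; try exact: cdecay_integrable.
- rewrite (cintegral_translate (B := fun x => e x * B x) h deB.1).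
  by rewrite rmorph_nat; ring.
- exact/cintegrableZ/cdecay_integrable.
Qed.

Lemma cmod_cintegral_expi_le C B xi : lipschitz_decay C B ->
  cmod (cintegral (fun x => expi (- xi * x) * B x)) <= 4 * pi * C * decay 1 xi.
Proof.
move=> lB; have dB := lipschitz_decay_cdecay lB; have [BC dBC] := lB.
have C0 := ge0_le_decay BC; have pi2 : 2 <= pi :> R := pi_ge2 R.
have rho := decay1_mul xi; have rho0 := decay_ge0 1 xi.
have [xi1|xi1] := ltrP `|xi| 1.
  apply: (@le_trans _ _ (4 * C)).
    apply: cmod_cintegral_le => [|x]; first exact/cdecay_integrable/cdecay_expiM.
    by rewrite cmodM cmod_expi mul1r.
  have : 1 <= pi * decay 1 xi by nra.
  by move=> /(ler_wpM2l C0); lra.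
have xi0 : xi != 0 by rewrite -normr_gt0 (lt_le_trans _ xi1).
have hE : `|pi / xi| = pi / `|xi| by rewrite normrM normfV ger0_norm ?pi_ge0.
have hpi : `|pi / xi| <= pi by rewrite hE ler_pdivrMr ?normr_gt0 // ler_peMr ?pi_ge0.
have hrho : `|pi / xi| <= 2 * pi * decay 1 xi.
  rewrite hE ler_pdivrMr ?normr_gt0 //.
  have : 1 <= 2 * (decay 1 xi * `|xi|) by nra.
  by move=> /(ler_wpM2l (pi_ge0 R)); lra.
have : cmod (2%:C * cintegral (fun x => expi (- xi * x) * B x)) <= 4 * (C * `|pi / xi|).
  rewrite cintegral_expi_half_period // cmodN; apply: cmod_cintegral_le => [|x].
    under eq_fun do rewrite mulrBr -[X in _ - X]mul1r -mulNr.
    apply: cintegrableD; last exact/cintegrableZ/cdecay_integrable/cdecay_expiM.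
    exact/cdecay_integrable/cdecay_expiM/cdecay_translate.
  by rewrite cmodM cmod_expi mul1r; exact: dBC.
rewrite cmodM cmod_real ger0_norm // => bound.
by have := ler_wpM2l C0 hrho; lra.
Qed.

End ComplexIntegral.

Section IteratedIntegrals.
Context {R : realType}.
Implicit Types (F G : seq R -> R[i]) (a : R[i]) (k : nat).

Fixpoint iter_cintegral k F : R[i] := match k with
  | 0 => F [::]
  | k'.+1 => cintegral (fun x => iter_cintegral k' (fun s => F (x :: s)))
  end.

Fixpoint iter_cintegrable k F : Prop := match k with
  | 0 => True
  | k'.+1 => (forall x, iter_cintegrable k' (fun s => F (x :: s))) /\
      cintegrable (fun x => iter_cintegral k' (fun s => F (x :: s)))
  end.

Lemma iterint_Re_Im k F : iter_cintegrable k F ->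
  iterint k (fun s => (complex.Re (F s))%:E) = (complex.Re (iter_cintegral k F))%:E /\
  iterint k (fun s => (complex.Im (F s))%:E) = (complex.Im (iter_cintegral k F))%:E.
Proof.
elim: k F => [//|k IH] F /= [Fs [hr hi]].
rewrite /Rintegral !fineK; try exact: integrable_fin_num.
by split; apply: eq_integral => x _; have [] := IH _ (Fs x).
Qed.

Lemma iter_cintegralD k F G : iter_cintegrable k F -> iter_cintegrable k G ->
  iter_cintegral k (fun s => F s + G s) = iter_cintegral k F + iter_cintegral k G.
Proof.
elim: k F G => [//|k IH] F G /= [Fs Fi] [Gs Gi].
by rewrite -cintegralD //; congr cintegral; apply/funext => x; exact: IH.
Qed.

Lemma iter_cintegrableD k F G : iter_cintegrable k F -> iter_cintegrable k G ->
  iter_cintegrable k (fun s => F s + G s).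
Proof.
elim: k F G => [//|k IH] F G /= [Fs Fi] [Gs Gi]; split=> [x|]; first exact: IH.
by under eq_fun => x do rewrite iter_cintegralD //; exact: cintegrableD.
Qed.

Lemma iter_cintegralZ k a F : iter_cintegrable k F ->
  iter_cintegral k (fun s => a * F s) = a * iter_cintegral k F.
Proof.
elim: k F => [//|k IH] F /= [Fs Fi].
by rewrite -cintegralZ //; congr cintegral; apply/funext => x; exact: IH.
Qed.

Lemma iter_cintegrableZ k a F : iter_cintegrable k F -> iter_cintegrable k (fun s => a * F s).
Proof.
elim: k F => [//|k IH] F /= [Fs Fi]; split=> [x|]; first exact: IH.
by under eq_fun => x do rewrite iter_cintegralZ //; exact: cintegrableZ.
Qed.

Lemma iter_cintegrableB k F G : iter_cintegrable k F -> iter_cintegrable k G ->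
  iter_cintegrable k (fun s => F s - G s).
Proof.
move=> Fi Gi; under eq_fun do rewrite -mulN1r.
exact/iter_cintegrableD/iter_cintegrableZ.
Qed.

Lemma iter_cintegralB k F G : iter_cintegrable k F -> iter_cintegrable k G ->
  iter_cintegral k (fun s => F s - G s) = iter_cintegral k F - iter_cintegral k G.
Proof.
move=> Fi Gi; under eq_fun do rewrite -mulN1r.
by rewrite iter_cintegralD ?iter_cintegralZ ?mulN1r //; exact: iter_cintegrableZ.
Qed.

Lemma cmod_iter_cintegral_le k F (C : R) : 0 <= C -> iter_cintegrable k F ->
  (forall s, size s = k -> cmod (F s) <= C * \prod_(i < k) decay 2 (nth 0 s i)) ->
  cmod (iter_cintegral k F) <= 4 ^+ k * C.
Proof.
elim: k F C => [|k IH] F C C0.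
  by move=> _ /(_ [::] erefl); rewrite big_ord0 expr0 mul1r mulr1.
move=> [Fs Fi] FC; rewrite exprS -mulrA; apply: cmod_cintegral_le Fi _ => x.
rewrite -mulrA; apply: IH (Fs x) _ => [|s sk]; first by rewrite mulr_ge0 // decay_ge0.
by have := FC (x :: s); rewrite /= sk big_ord_recl /= mulrA; exact.
Qed.

End IteratedIntegrals.

Section MixedLipschitz.
Context {R : realType}.
Implicit Types (v w : nat -> R -> R) (b : seq R -> R[i]) (C D K : R) (k : nat).

Definition slowly_varying K (w : R -> R) := forall x h, `|h| <= pi -> w (x + h) <= K * w x.

Lemma slowly_varying_decay k (y : R) :
  slowly_varying ((1 + pi) ^+ k) (fun x => decay k (x - y)).
Proof. by move=> x h hpi; rewrite addrAC; exact: decay_translate_le. Qed.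

(* Every coordinate is either frozen or differenced once. *)
Fixpoint mixed_lipschitz k w C b : Prop := match k with
  | 0 => cmod (b [::]) <= C
  | k'.+1 =>
      (forall x, mixed_lipschitz k' (fun i => w i.+1) (C * w 0 x) (fun s => b (x :: s))) /\
      (forall x h, `|h| <= pi -> mixed_lipschitz k' (fun i => w i.+1) (C * `|h| * w 0 x)
         (fun s => b (x + h :: s) - b (x :: s)))
  end.

Lemma mixed_lipschitz_weight k v w (c : nat -> R) C C' b :
  (forall i x, 0 <= v i x) -> (forall i x, v i x <= c i * w i x) ->
  (forall i x, 0 <= w i x) -> (forall i, 0 <= c i) -> 0 <= C ->
  C * (\prod_(i < k) c i) <= C' -> mixed_lipschitz k v C b -> mixed_lipschitz k w C' b.
Proof.
elim: k v w c C C' b => [|k IH] v w c C C' b v0 vw w0 c0 C0.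
  by rewrite big_ord0 mulr1 => CC' /le_trans; apply.
rewrite big_ord_recl /= => CC' [bs bd].
have P0 : 0 <= \prod_(i < k) c (bump 0 i) by apply: prodr_ge0.
have freeze D x b' : 0 <= D -> mixed_lipschitz k (fun i => v i.+1) (C * D * v 0 x) b' ->
    mixed_lipschitz k (fun i => w i.+1) (C' * D * w 0 x) b'.
  move=> D0; apply: (IH _ _ (fun i => c i.+1)) => //; first by rewrite !mulr_ge0.
  apply: (@le_trans _ _ (C * (c 0 * \prod_(i < k) c (bump 0 i)) * D * w 0 x)); last first.
    by rewrite ler_wpM2r // ler_wpM2r.
  have := ler_wpM2l (mulr_ge0 (mulr_ge0 C0 D0) P0) (vw 0 x).
  by rewrite (_ : \prod_(i < k) c i.+1 = \prod_(i < k) c (bump 0 i)) //; lra.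
split=> [x|x h hpi]; last exact: freeze (bd x h hpi).
by have := freeze 1 x _ ler01; rewrite !mulr1; apply; exact: bs.
Qed.

Lemma mixed_lipschitz_le k w C C' b : (forall i x, 0 <= w i x) ->
  0 <= C -> C <= C' -> mixed_lipschitz k w C b -> mixed_lipschitz k w C' b.
Proof.
move=> w0 C0 CC'; apply: (@mixed_lipschitz_weight _ _ _ (fun=> 1)) => // [i x|].
  by rewrite mul1r.
by rewrite big1 // mulr1.
Qed.

Lemma mixed_lipschitzD k w C D b b' : mixed_lipschitz k w C b -> mixed_lipschitz k w D b' ->
  mixed_lipschitz k w (C + D) (fun s => b s + b' s).
Proof.
elim: k w C D b b' => [|k IH] w C D b b' /=.
  by move=> bC bD; rewrite (le_trans (ler_cmodD _ _)) // lerD.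
move=> [bs bd] [bs' bd']; split=> [x|x h hpi]; first by rewrite mulrDl; exact: IH.
rewrite -mulrA mulrDl !mulrA.
under [X in mixed_lipschitz _ _ _ X]eq_fun do rewrite opprD addrACA.
exact: IH (bd x h hpi) (bd' x h hpi).
Qed.

Lemma mixed_lipschitzZ k w C (z : R[i]) b : mixed_lipschitz k w C b ->
  mixed_lipschitz k w (cmod z * C) (fun s => z * b s).
Proof.
elim: k w C b => [|k IH] w C b /=; first by move=> bC; rewrite cmodM ler_wpM2l // cmod_ge0.
move=> [bs bd]; split=> [x|x h hpi]; first by rewrite -mulrA; exact: IH.
have := IH _ _ _ (bd x h hpi); rewrite !mulrA.
by under [X in mixed_lipschitz _ _ _ X]eq_fun do rewrite mulrBr.
Qed.

Lemma mixed_lipschitzM k v w C D K b b' : 0 <= C -> 0 <= D -> 0 <= K ->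
  (forall i x, 0 <= v i x) -> (forall i x, 0 <= w i x) ->
  (forall i, slowly_varying K (w i)) ->
  mixed_lipschitz k v C b -> mixed_lipschitz k w D b' ->
  mixed_lipschitz k (fun i x => v i x * w i x) ((1 + K) ^+ k * (C * D)) (fun s => b s * b' s).
Proof.
move=> + + K0; elim: k v w C D b b' => [|k IH] v w C D b b' C0 D0 v0 w0 wK /=.
  by rewrite expr0 mul1r cmodM => bC b'D; apply: ler_pM; rewrite ?cmod_ge0.
move=> [bs bd] [bs' bd'].
have P0 : 0 <= (1 + K) ^+ k by rewrite exprn_ge0 // addr_ge0.
have vw0 i x : 0 <= v i.+1 x * w i.+1 x by rewrite mulr_ge0.
have {}IH C1 D1 c c' (C10 : 0 <= C1) (D10 : 0 <= D1) :=
  IH (fun i => v i.+1) (fun i => w i.+1) C1 D1 c c' C10 D10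
  (fun i => v0 i.+1) (fun i => w0 i.+1) (fun i => wK i.+1).
split=> [x|x h hpi].
- apply: mixed_lipschitz_le (IH _ _ _ _ _ _ (bs x) (bs' x)) => //; rewrite ?mulr_ge0 //.
  have -> : (1 + K) ^+ k.+1 * (C * D) * (v 0 x * w 0 x) =
      (1 + K) * ((1 + K) ^+ k * (C * v 0 x * (D * w 0 x))) by rewrite exprS; ring.
  by rewrite ler_peMl ?mulr_ge0 // lerDl.
- have -> : (fun s => b (x + h :: s) * b' (x + h :: s) - b (x :: s) * b' (x :: s)) =
      (fun s => (b (x + h :: s) - b (x :: s)) * b' (x + h :: s) +
         b (x :: s) * (b' (x + h :: s) - b' (x :: s))).
    by apply/funext => s; ring.
  apply: mixed_lipschitz_le (mixed_lipschitzD (IH _ _ _ _ _ _ (bd x h hpi) (bs' (x + h)))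
    (IH _ _ _ _ _ _ (bs x) (bd' x h hpi))) => //; rewrite ?addr_ge0 ?mulr_ge0 //.
  have -> : (1 + K) ^+ k.+1 * (C * D) * `|h| * (v 0 x * w 0 x) =
      (1 + K) ^+ k * (C * `|h| * v 0 x * (D * (K * w 0 x))) +
      (1 + K) ^+ k * (C * v 0 x * (D * `|h| * w 0 x)) by rewrite exprS; ring.
  rewrite lerD2r ler_wpM2l // ler_wpM2l ?mulr_ge0 // ler_wpM2l //.
  exact: wK.
Qed.

End MixedLipschitz.

Section OscillatoryIntegrals.
Context {R : realType}.
Implicit Types (xi : nat -> R) (b : seq R -> R[i]) (u : R -> R[i]) (C c : R) (k : nat).

Definition character k xi (s : seq R) : R[i] := expi (- \sum_(i < k) xi i * nth 0 s i).

Lemma character_cons k xi (x : R) (s : seq R) : character k.+1 xi (x :: s) =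
  expi (- xi 0 * x) * character k (fun i => xi i.+1) s.
Proof. by rewrite /character big_ord_recl opprD expiD mulNr. Qed.

Definition partial_transform k xi b (x : R) : R[i] :=
  iter_cintegral k (fun s => b (x :: s) * character k xi s).

Definition oscillation_bound k := forall xi C b, mixed_lipschitz k (fun=> decay 2) C b ->
  iter_cintegrable k (fun s => b s * character k xi s) /\
  cmod (iter_cintegral k (fun s => b s * character k xi s)) <=
    C * (4 * pi) ^+ k * \prod_(i < k) decay 1 (xi i).

Lemma lipschitz_partial_transform k : oscillation_bound k -> forall xi C b,
  mixed_lipschitz k.+1 (fun=> decay 2) C b ->
  lipschitz_decay (C * (4 * pi) ^+ k * \prod_(i < k) decay 1 (xi i))
    (partial_transform k xi b).
Proof.
move=> bound xi C b [bs bd]; split=> [x|x h hpi].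
  by have := (bound xi _ _ (bs x)).2; rewrite /partial_transform; lra.
rewrite /partial_transform -iter_cintegralB; [|exact: (bound _ _ _ (bs _)).1..].
under [X in iter_cintegral _ X]eq_fun do rewrite -mulrBl.
by have := (bound xi _ _ (bd x h hpi)).2; lra.
Qed.

Lemma iter_cintegral_mul_head k : oscillation_bound k -> forall xi C c b u,
  mixed_lipschitz k.+1 (fun=> decay 2) C b -> ccontinuous u -> (forall x, cmod (u x) <= c) ->
  let F s := u (head 0 s) * (b s * character k.+1 xi s) in
  iter_cintegrable k.+1 F /\
  iter_cintegral k.+1 F = cintegral (fun x => u x *
    (expi (- xi 0 * x) * partial_transform k (fun i => xi i.+1) b x)).
Proof.
move=> bound xi C c b u lb cu uc F; have [bs _] := lb; pose xi' i := xi i.+1.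
have E x : (fun s => F (x :: s)) =
    (fun s => (u x * expi (- xi 0 * x)) * (b (x :: s) * character k xi' s)).
  by apply/funext => s; rewrite /F character_cons /=; ring.
have Fx x : iter_cintegral k (fun s => F (x :: s)) =
    u x * (expi (- xi 0 * x) * partial_transform k xi' b x).
  by rewrite E iter_cintegralZ ?mulrA //; exact: (bound xi' _ _ (bs x)).1.
split=> /=; last by congr cintegral; apply/funext.
split=> [x|]; first by rewrite E; exact: iter_cintegrableZ (bound xi' _ _ (bs x)).1.
under eq_fun do rewrite Fx; apply: cdecay_integrable; apply: cdecayM cu uc _.
exact/cdecay_expiM/lipschitz_decay_cdecay/(lipschitz_partial_transform bound xi' lb).
Qed.

Lemma oscillation_boundP k : oscillation_bound k.
Proof.
elim: k => [|k IH] xi C b lb.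
  by rewrite /= /character !big_ord0 oppr0 expi0 !mulr1.
have u1 : cmod (1 : R[i]) <= 1 by rewrite -(@expi0 R) cmod_expi.
have [+ E] := iter_cintegral_mul_head IH xi lb (ccontinuous_cst 1) (fun=> u1).
move: E; under [X in iter_cintegral _ X]eq_fun do rewrite mul1r.
under [X in iter_cintegrable _ X]eq_fun do rewrite mul1r.
move=> E Fi; split=> [//|]; rewrite {}E {Fi}; under [X in cintegral X]eq_fun do rewrite mul1r.
have := cmod_cintegral_expi_le (xi 0) (lipschitz_partial_transform IH (fun i => xi i.+1) lb).
by rewrite big_ord_recl exprS /=; lra.
Qed.

End OscillatoryIntegrals.

Section PartialDerivatives.
Context {R : realType} {n : nat}.
Implicit Types (f g : 'rV[R]_n -> R) (t u v : 'rV[R]_n) (es : seq 'I_n) (c d h r : R).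
Local Notation "''e_' i" := (delta_mx 0 i) (at level 8, i at level 2, format "''e_' i").

Lemma is_derive_line f t v r d :
  is_derive r 1 (fun r' : R => f (t + r' *: v)) d <-> is_derive (t + r *: v) v f d.
Proof.
have E : (fun h : R => h^-1 *: (f (t + (h *: 1 + r) *: v) - f (t + r *: v))) =
    (fun h : R => h^-1 *: (f (h *: v + (t + r *: v)) - f (t + r *: v))).
  by apply/funext => h; rewrite [h%:A]mulr1 scalerDl addrCA.
by split=> -[fv fd]; split; [move: fv|move: fd|move: fv|move: fd];
  rewrite /derivable /derive /= E.
Qed.

Lemma MVT_direction f v : (forall t, derivable f t v) -> forall t h,
  exists2 th, `|th| <= `|h| & f (t + h *: v) - f t = h * 'D_v f (t + th *: v).
Proof.
move=> df t h; have dline r : is_derive r 1 (fun r' : R => f (t + r' *: v)) ('D_v f (t + r *: v)).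
  by apply/is_derive_line; exact: derivableP.
have [th thh] := MVT_increment dline 0 h.
by rewrite !add0r scale0r addr0; exists th.
Qed.

Lemma derivable_translate f t u v :
  derivable (fun x => f (x + u)) t v <-> derivable f (t + u) v.
Proof. by rewrite /derivable /=; under eq_fun do rewrite -addrA. Qed.

Lemma derive_translate f t u v : 'D_v (fun x => f (x + u)) t = 'D_v f (t + u).
Proof. by rewrite /derive /=; under eq_fun do rewrite -addrA. Qed.

Definition smooth f := forall es i t, derivable (pder es f) t 'e_i.

Lemma pder_translate f u es : pder es (fun x => f (x + u)) = (fun x => pder es f (x + u)).
Proof.
by elim: es => [//|i es IH] /=; apply/funext => t; rewrite IH derive_translate.
Qed.

Lemma smooth_translate f u : smooth f -> smooth (fun x => f (x + u)).
Proof. by move=> sf es i t; rewrite pder_translate; apply/derivable_translate; exact: sf. Qed.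

Lemma is_derive_linear c f g t v : derivable f t v -> derivable g t v ->
  is_derive t v (fun x => c * f x + g x) (c * 'D_v f t + 'D_v g t).
Proof. by move=> df dg; exact: is_deriveD (is_deriveZ c (derivableP df)) (derivableP dg). Qed.

Lemma pder_linear c f g es : smooth f -> smooth g ->
  pder es (fun x => c * f x + g x) = (fun x => c * pder es f x + pder es g x).
Proof.
move=> sf sg; elim: es => [//|i es IH] /=; apply/funext => t; rewrite IH.
by have [_ ->] := is_derive_linear c (sf es i t) (sg es i t).
Qed.

Lemma smooth_linear c f g : smooth f -> smooth g -> smooth (fun x => c * f x + g x).
Proof.
move=> sf sg es i t; rewrite pder_linear //.
by have [] := is_derive_linear c (sf es i t) (sg es i t).
Qed.

Lemma pder_increment f u es : smooth f ->
  pder es (fun x => f (x + u) - f x) = (fun x => pder es f (x + u) - pder es f x).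
Proof.
move=> sf; rewrite (_ : (fun x => _ - _) = (fun x => -1 * f x + f (x + u))); last first.
  by apply/funext => x; rewrite mulN1r addrC.
rewrite (pder_linear _ _ sf (smooth_translate sf)) pder_translate.
by apply/funext => x; rewrite mulN1r addrC.
Qed.

Lemma smooth_increment f u : smooth f -> smooth (fun x => f (x + u) - f x).
Proof.
move=> sf es i t; rewrite pder_increment //.
by apply: derivableB; [apply/derivable_translate|]; exact: sf.
Qed.

Lemma pder_rcons f es i : pder (rcons es i) f = pder es (fun t => 'D_'e_i f t).
Proof. by elim: es => [//|j es IH] /=; rewrite IH. Qed.

Lemma norm_increment_le f (L : R) : (forall i t, derivable f t 'e_i) ->
  (forall i t, `|'D_'e_i f t| <= L) ->
  forall t u, `|f (t + u) - f t| <= L * \sum_(i < n) `|u 0 i|.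
Proof.
move=> df fL t u; rewrite {1}(row_sum_delta u).
elim: (index_enum _) t => [|i l IH] t.
  by rewrite !big_nil mulr0 addr0 subrr normr0.
rewrite !big_cons addrA mulrDr.
have [th _ E] := MVT_direction (df i) t (u 0 i).
rewrite -(subrKA (f (t + u 0 i *: 'e_i))) [leRHS]addrC (le_trans (ler_normD _ _)) // lerD //.
by rewrite E normrM mulrC ler_wpM2r.
Qed.

Lemma norm_increment_continuous f (L : R) : 0 <= L ->
  (forall t u, `|f (t + u) - f t| <= L * \sum_(i < n) `|u 0 i|) -> continuous f.
Proof.
move=> L0 fL x; apply/(@cvgrPdist_le _ _ _ (nbhs x) (nbhs_filter x)) => e e0.
have L1 : 0 < L * n%:R + 1 by rewrite ltr_pwDr // mulr_ge0.
have d0 : 0 < e / (L * n%:R + 1) by rewrite divr_gt0.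
apply/nbhs_ballP; exists (e / (L * n%:R + 1)) => // y [_ xy].
rewrite distrC -{1}(subrKC x y) (le_trans (fL _ _)) //.
apply: (@le_trans _ _ (L * \sum_(i < n) (e / (L * n%:R + 1)))).
  by rewrite ler_wpM2l // ler_sum // => i _; rewrite !mxE distrC ltW //; exact: xy.
rewrite sumr_const card_ord -(mulr_natr (e / _)).
have -> : L * ((e / (L * n%:R + 1)) * n%:R) = e * ((L * n%:R) / (L * n%:R + 1)) by ring.
by rewrite ler_piMr ?(ltW e0) // ler_pdivrMr // mul1r lerDl.
Qed.

End PartialDerivatives.

Section SchwartzClosure.
Context {R : realType} {n : nat}.
Implicit Types (f g : 'rV[R]_n -> R) (F G : 'rV[R]_n -> R[i]) (i j : 'I_n) (a b c : R).
Local Notation "''e_' i" := (delta_mx 0 i) (at level 8, i at level 2, format "''e_' i").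

Lemma enorm_weight_ge0 (t : 'rV[R]_n) (N : nat) : 0 <= (1 + enorm t) ^+ N.
Proof. by rewrite exprn_ge0 // addr_ge0 // sqrtr_ge0. Qed.

Lemma schwartz_real_linear c f g : schwartz_real f -> schwartz_real g ->
  schwartz_real (fun t => c * f t + g t).
Proof.
move=> [sf bf] [sg bg]; split; first exact: smooth_linear.
move=> es N; have [A fA] := bf es N; have [B gB] := bg es N.
exists (`|c| * A + B) => t; rewrite pder_linear //.
rewrite (le_trans (ler_wpM2l (enorm_weight_ge0 t N) (ler_normD _ _))) //.
by rewrite mulrDr lerD // normrM mulrCA ler_wpM2l.
Qed.

Lemma schwartz_real_derive g i : schwartz_real g -> schwartz_real (fun t => 'D_'e_i g t).
Proof.
move=> [sg bg]; split=> [es|es N]; rewrite -pder_rcons; first exact: sg.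
exact: bg.
Qed.

(* Contains the iterated partial derivatives of [cos (a * t 0 j + b) * g t]. *)
Inductive cos_span a j : ('rV[R]_n -> R) -> Prop :=
| cos_span_base b g : schwartz_real g -> cos_span a j (fun t => cos (a * t 0 j + b) * g t)
| cos_span_linear c f g : cos_span a j f -> cos_span a j g ->
    cos_span a j (fun t => c * f t + g t).

Lemma is_derive_cosM a b j i g t : derivable g t 'e_i ->
  is_derive t 'e_i (fun t => cos (a * t 0 j + b) * g t)
    (a * (i == j)%:R * (cos (a * t 0 j + (b + pi / 2)) * g t) +
     cos (a * t 0 j + b) * 'D_'e_i g t).
Proof.
move=> dg; have dcos : is_derive t 'e_i (fun t => cos (a * t 0 j + b))
    (a * (i == j)%:R * cos (a * t 0 j + (b + pi / 2))).
  rewrite -{1}[t]addr0 -(scale0r 'e_i); apply/is_derive_line.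
  have -> : (fun r : R => cos (a * (t + r *: 'e_i) 0 j + b)) =
      (fun r : R => cos (a * (i == j)%:R * r + (a * t 0 j + b))).
    by apply/funext => r; congr cos; rewrite !mxE eqxx /= eq_sym; ring.
  have daff : is_derive (0 : R) 1 (fun r : R => a * (i == j)%:R * r + (a * t 0 j + b))
      (a * (i == j)%:R).
    by apply: is_derive_eq; rewrite addr0 [_ *: 1]mulr1.
  apply: is_derive_eq (is_derive1_comp (is_derive_cos _) daff) _.
  by rewrite mulr0 add0r addrA cosDpihalf mulrC.
apply: is_derive_eq (is_deriveM dcos (derivableP dg)) _.
by rewrite /GRing.scale /=; ring.
Qed.

Lemma cos_span_derive a j i f : cos_span a j f ->
  (forall t, derivable f t 'e_i) /\ cos_span a j (fun t => 'D_'e_i f t).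
Proof.
elim=> [b g sg|c g h _ [dg og] _ [dh oh]].
- have D t := is_derive_cosM a b j (sg.1 [::] i t).
  split=> [t|]; first by have [] := D t.
  under eq_fun => t do have [_ ->] := D t.
  by apply: cos_span_linear; apply: cos_span_base; last exact: schwartz_real_derive.
- have D t := is_derive_linear c (dg t) (dh t).
  split=> [t|]; first by have [] := D t.
  by under eq_fun => t do have [_ ->] := D t; exact: cos_span_linear.
Qed.

Lemma cos_span_decay a j f (N : nat) : cos_span a j f ->
  exists C : R, forall t, (1 + enorm t) ^+ N * `|f t| <= C.
Proof.
elim=> [b g sg|c g h _ [A gA] _ [B hB]].
- have [C gC] := sg.2 [::] N; exists C => t; apply: le_trans (gC t).
  by rewrite ler_wpM2l ?enorm_weight_ge0 // normrM ler_piMl // cos_max.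
- exists (`|c| * A + B) => t.
  rewrite (le_trans (ler_wpM2l (enorm_weight_ge0 t N) (ler_normD _ _))) //.
  by rewrite mulrDr lerD // normrM mulrCA ler_wpM2l.
Qed.

Lemma schwartz_real_cosM a b j g : schwartz_real g ->
  schwartz_real (fun t => cos (a * t 0 j + b) * g t).
Proof.
move=> sg; set f := fun t => _.
have span es : cos_span a j (pder es f).
  elim: es => [|i es IH] /=; first exact: cos_span_base.
  exact: (cos_span_derive i IH).2.
split=> [es i t|es N]; first exact: (cos_span_derive i (span es)).1.
exact: cos_span_decay (span es).
Qed.

Lemma schwartz_linear (z : R[i]) F G : schwartz F -> schwartz G ->
  schwartz (fun t => z * F t + G t).
Proof.
case: z => a b [Fr Fi] [Gr Gi]; split.
- have := schwartz_real_linear a Fr (schwartz_real_linear (- b) Fi Gr).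
  by congr schwartz_real; apply/funext => t; case: (F t) (G t) => [? ?] [? ?] /=; ring.
- have := schwartz_real_linear a Fi (schwartz_real_linear b Fr Gi).
  by congr schwartz_real; apply/funext => t; case: (F t) (G t) => [? ?] [? ?] /=; ring.
Qed.

Lemma schwartz_expiM a j F : schwartz F -> schwartz (fun t => expi (a * t 0 j) * F t).
Proof.
move=> [Fr Fi]; have cosE (x : R) : cos x = cos (x + 0) by rewrite addr0.
have sinE (x : R) : sin x = cos (x + - (pi / 2)) by rewrite cosBpihalf.
split.
- have := schwartz_real_linear (-1) (schwartz_real_cosM a (- (pi / 2)) j Fi)
    (schwartz_real_cosM a 0 j Fr).
  by congr schwartz_real; apply/funext => t; rewrite ReM /= -sinE -cosE mulN1r addrC.
- have := schwartz_real_linear 1 (schwartz_real_cosM a 0 j Fi)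
    (schwartz_real_cosM a (- (pi / 2)) j Fr).
  by congr schwartz_real; apply/funext => t; rewrite ImM /= -sinE -cosE mul1r.
Qed.

End SchwartzClosure.

Section NonnegativeIteratedIntegrals.
Context {R : realType}.
Let mu := @lebesgue_measure R.
Implicit Types (F G : seq R -> \bar R) (g : nat -> R -> R) (I a b : nat -> R) (c : R) (k : nat).

(* Holds without measurability because the integral of a nonnegative function
   is a supremum over the simple functions below it. *)
Lemma ge0_le_integral_nonmeasurable (f g : R -> \bar R) :
  (forall x, 0 <= f x)%E -> (forall x, f x <= g x)%E ->
  (\int[mu]_x f x <= \int[mu]_x g x)%E.
Proof.
move=> f0 fg; have g0 x : (0 <= g x)%E by apply: le_trans (fg x).
rewrite !ge0_integralE //; apply: ereal_sup_le => _ [h hf <-]; exists h => //.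
by move=> x; apply: le_trans (hf x) _; rewrite !patch_setT.
Qed.

Lemma iterint_ge0 k F : (forall s, 0 <= F s)%E -> (0 <= iterint k F)%E.
Proof.
elim: k F => [|k IH] F F0 /=; first exact: F0.
by apply: integral_ge0 => x _; apply: IH => s; exact: F0.
Qed.

Lemma iterint_le k F G : (forall s, 0 <= F s)%E ->
  (forall s, size s = k -> F s <= G s)%E -> (iterint k F <= iterint k G)%E.
Proof.
elim: k F G => [|k IH] F G F0 FG /=; first exact: FG.
apply: ge0_le_integral_nonmeasurable => x; first exact: iterint_ge0.
by apply: IH => // s sk; apply: FG; rewrite /= sk.
Qed.

Lemma iterint0 k : iterint k (fun _ : seq R => 0%E) = 0%E.
Proof. by elim: k => [//|k IH] /=; under eq_integral do rewrite IH; rewrite integral0. Qed.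

Lemma iterint_prod k g I c :
  (forall i, measurable_fun [set: measurableTypeR R] (g i)) -> (forall i x, 0 <= g i x) ->
  (forall i, (\int[mu]_x (g i x)%:E)%E = (I i)%:E) -> 0 <= c ->
  iterint k (fun s => (c * \prod_(i < k) g i (nth 0 s i))%:E) = (c * \prod_(i < k) I i)%:E.
Proof.
elim: k g I c => [|k IH] g I c mg g0 gI c0 /=; first by rewrite !big_ord0.
have I0 i : 0 <= I i by rewrite -lee_fin -gI; apply: integral_ge0 => x _; rewrite lee_fin.
transitivity (\int[mu]_x ((c * \prod_(i < k) I i.+1)%:E * (g 0%N x)%:E))%E.
  apply: eq_integral => x _; rewrite -EFinM mulrAC.
  rewrite -(IH (fun i => g i.+1) (fun i => I i.+1)) ?mulr_ge0 //; congr iterint.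
  by apply/funext => s; rewrite big_ord_recl /= mulrA.
rewrite ge0_integralZl_EFin //.
- by rewrite gI -EFinM big_ord_recl mulrAC mulrA.
- by move=> x _; rewrite lee_fin.
- exact/measurable_EFinP.
- by rewrite mulr_ge0 // prodr_ge0.
Qed.

Lemma integral_indic_itv (a b : R) : a <= b ->
  (\int[mu]_y (\1_(`[a, b]%classic : set R) y)%:E = (b - a)%:E)%E.
Proof.
move=> ab; rewrite integral_indic // setIT.
rewrite [LHS]lebesgue_measure_itv /= lte_fin.
by case: (ltgtP a b) ab => // -> _; rewrite subrr.
Qed.

Lemma iterint_ge_box k F a b c : (forall i, a i <= b i) -> 0 <= c -> (forall s, 0 <= F s)%E ->
  (forall s, size s = k -> (forall i, (i < k)%N -> a i <= nth 0 s i <= b i) -> (c%:E <= F s)%E) ->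
  ((c * \prod_(i < k) (b i - a i))%:E <= iterint k F)%E.
Proof.
move=> ab c0 F0 cF; pose g i : R -> R := \1_(`[a i, b i]%classic : set R).
rewrite -(@iterint_prod k g (fun i => b i - a i)) // => [|i|i].
- apply: iterint_le => [s|s sk]; first by rewrite lee_fin mulr_ge0 // prodr_ge0.
  have [/forallP sab|/forallPn [i iab]] := boolP [forall i : 'I_k, a i <= nth 0 s i <= b i].
    rewrite big1 ?mulr1; last first.
      by move=> i _; rewrite /g indicE mem_set //= in_itv /=; exact: sab.
    by apply: cF => // i ik; exact: (sab (Ordinal ik)).
  rewrite (bigD1 i) //= /g indicE memNset ?mul0r ?mulr0 //=.
  by rewrite in_itv /=; apply/negP.
- exact: measurable_indic.
- exact: integral_indic_itv.
Qed.

End NonnegativeIteratedIntegrals.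

Section SchwartzBounds.
Context {R : realType} {n : nat}.
Implicit Types (f : 'rV[R]_n -> R) (F G : 'rV[R]_n -> R[i]) (t y : 'rV[R]_n)
  (w : nat -> R -> R) (A K : R) (pre s : seq R) (N : nat).
Local Notation "''e_' i" := (delta_mx 0 i) (at level 8, i at level 2, format "''e_' i").

Definition pder_bound w m A f := forall es, (size es <= m)%N ->
  forall t, `|pder es f t| <= A * \prod_(i < n) w i (t 0 i).

Lemma slowly_varying_prod w K : (forall i x, 0 <= w i x) ->
  (forall i, slowly_varying K (w i)) -> forall t i (h : R), `|h| <= pi ->
  \prod_(j < n) w j ((t + h *: 'e_i) 0 j) <= K * \prod_(j < n) w j (t 0 j).
Proof.
move=> w0 wK t i h hpi; rewrite (bigD1 i) //= [X in _ <= _ * X](bigD1 i) //= mulrA.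
apply: ler_pM => //; first by apply: prodr_ge0.
  by rewrite !mxE !eqxx /= mulr1; exact: wK.
apply: ler_prod => j ji; rewrite w0 !mxE /=.
by rewrite (negbTE ji) mulr0 addr0.
Qed.

Lemma pder_bound_increment w K A m f i (h : R) : (forall i x, 0 <= w i x) ->
  (forall i, slowly_varying K (w i)) -> 0 <= A -> smooth f -> pder_bound w m.+1 A f ->
  `|h| <= pi -> pder_bound w m (`|h| * K * A) (fun t => f (t + h *: 'e_i) - f t).
Proof.
move=> w0 wK A0 sf bf hpi es es_m t; rewrite pder_increment //.
have [th th_h ->] := MVT_direction (sf es i) t h.
rewrite normrM -!mulrA ler_wpM2l // mulrCA.
apply: le_trans (bf (i :: es) es_m _) _; rewrite ler_wpM2l //.
by apply: slowly_varying_prod; rewrite ?(le_trans th_h).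
Qed.

Lemma rowOfSeq_increment pre s (x h : R) (lt : (size pre < n)%N) :
  rowOfSeq n (pre ++ x + h :: s) = rowOfSeq n (pre ++ x :: s) + h *: 'e_(Ordinal lt).
Proof.
apply/rowP => j; rewrite !mxE !nth_cat /= -val_eqE /=.
have [jl|jl|je] := ltngtP j (size pre); rewrite ?mulr0 ?addr0 //.
- by move: jl; rewrite -subn_gt0; case: (j - size pre)%N.
- by rewrite je subnn mulr1.
Qed.

Lemma pder_bound_mixed_lipschitz w K : 1 <= K -> (forall i x, 0 <= w i x) ->
  (forall i, slowly_varying K (w i)) ->
  forall k pre f A, (size pre + k)%N = n -> 0 <= A -> smooth f -> pder_bound w k A f ->
  mixed_lipschitz k (fun i => w (size pre + i)%N)
    (K ^+ k * A * \prod_(i < size pre) w i (nth 0 pre i))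
    (fun s => Complex (f (rowOfSeq n (pre ++ s))) 0).
Proof.
move=> K1 w0 wK; have K0 : 0 <= K by apply: le_trans K1.
elim=> [|k IH] pre f A sz A0 sf bf.
  rewrite addn0 in sz; rewrite /= cats0 cmod_real expr0 mul1r.
  have := bf [::] isT (rowOfSeq n pre); rewrite /= sz => /le_trans; apply.
  by under eq_bigr do rewrite mxE.
have szx x : (size (rcons pre x) + k)%N = n by rewrite size_rcons addSnnS.
have prodE x : \prod_(i < size (rcons pre x)) w i (nth 0 (rcons pre x) i) =
    (\prod_(i < size pre) w i (nth 0 pre i)) * w (size pre) x.
  rewrite size_rcons big_ord_recr /= nth_rcons ltnn eqxx; congr (_ * _).
  by apply: eq_bigr => i _; rewrite nth_rcons ltn_ord.
have wE x : (fun i => w (size pre + i.+1)%N) = (fun i => w (size (rcons pre x) + i)%N).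
  by apply/funext => i; rewrite size_rcons addSnnS.
have P0 : 0 <= \prod_(i < size pre) w i (nth 0 pre i) by apply: prodr_ge0.
have lt : (size pre < n)%N by rewrite -sz addnS ltnS leq_addr.
split=> [x|x h hpi]; rewrite (wE x) addn0.
- under [X in mixed_lipschitz _ _ _ X]eq_fun do rewrite -cat_rcons.
  apply: mixed_lipschitz_le (IH (rcons pre x) f A (szx x) A0 sf _) => //.
  + by rewrite !mulr_ge0 ?exprn_ge0 // prodr_ge0.
  + rewrite prodE mulrA ler_wpM2r // ler_wpM2r // ler_wpM2r // exprS.
    by rewrite ler_peMl // exprn_ge0.
  + by move=> es es_k; apply: bf; exact: leqW.
- have := IH (rcons pre x) _ _ (szx x) _ (smooth_increment sf)
    (pder_bound_increment (Ordinal lt) w0 wK A0 sf bf hpi).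
  move/(_ (mulr_ge0 (mulr_ge0 (normr_ge0 h) K0) A0)); rewrite prodE.
  congr mixed_lipschitz; first by rewrite exprS; ring.
  apply/funext => s; rewrite rowOfSeq_increment cat_rcons.
  by apply/eqP; rewrite eq_complex /= subrr !eqxx.
Qed.

Lemma le_coord_enorm t (i : 'I_n) : `|t 0 i| <= enorm t.
Proof.
rewrite /enorm -sqrtr_sqr ler_wsqrtr // (bigD1 i) //= lerDl.
by apply: sumr_ge0 => j _; exact: sqr_ge0.
Qed.

Lemma schwartz_real_pder_bound f N : schwartz_real f ->
  exists2 A : R, 0 <= A & pder_bound (fun=> decay N) n A f.
Proof.
move=> [_ bf].
have [C fC] := boolp.choice (fun es => bf es (N * n)%N).
exists (\sum_(es : n.-bseq 'I_n) `|C es|); first exact: sumr_ge0.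
move=> es es_n t.
have e1 : 0 < 1 + enorm t by rewrite ltr_pwDl // sqrtr_ge0.
apply: (@le_trans _ _ (`|C es| * \prod_(i < n) decay N (t 0 i))); last first.
  by rewrite ler_wpM2r ?prod_decay_ge0 // (bigD1 (Bseq es_n)) //= lerDl sumr_ge0.
apply: (@le_trans _ _ (`|C es| * ((1 + enorm t) ^+ (N * n))^-1)).
  by rewrite ler_pdivlMr ?exprn_gt0 // mulrC (le_trans (fC es t)) // ler_norm.
rewrite ler_wpM2l // exprM -[n in _ ^+ n]card_ord -prodr_const -prodfV.
apply: ler_prod => i _; rewrite invr_ge0 exprn_ge0 ?(ltW e1) //=.
rewrite lef_pV2 ?posrE ?exprn_gt0 ?onep_normr_gt0 //.
apply: lerXn2r; rewrite ?nnegrE ?addr_ge0 ?sqrtr_ge0 //.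
by rewrite lerD2l le_coord_enorm.
Qed.

Lemma schwartz_decay F N : schwartz F ->
  exists2 C : R, 0 <= C & forall t, cmod (F t) <= C * \prod_(i < n) decay N (t 0 i).
Proof.
move=> [sr si]; have [A A0 bA] := schwartz_real_pder_bound N sr.
have [B B0 bB] := schwartz_real_pder_bound N si.
exists (A + B) => [|t]; first exact: addr_ge0.
rewrite (le_trans (cmod_le_Re_Im _)) // mulrDl lerD //.
- exact: (bA [::] isT t).
- exact: (bB [::] isT t).
Qed.

Lemma schwartz_real_lipschitz f : schwartz_real f ->
  exists2 L : R, 0 <= L & forall t y, `|f (t + y) - f t| <= L * \sum_(i < n) `|y 0 i|.
Proof.
move=> sf; have [A A0 bA] := schwartz_real_pder_bound 0 sf; exists A => //.
apply: norm_increment_le => [i t|i t]; first exact: (sf.1 [::]).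
have n0 : (0 < n)%N by case: (n) i => [[]|].
apply: le_trans (bA [:: i] n0 t) _.
by rewrite big1 ?mulr1 // => j _; rewrite /decay expr0 invr1.
Qed.

Lemma schwartz_lipschitz F : schwartz F ->
  exists2 L : R, 0 <= L & forall t y, cmod (F (t + y) - F t) <= L * \sum_(i < n) `|y 0 i|.
Proof.
move=> [sr si]; have [A A0 bA] := schwartz_real_lipschitz sr.
have [B B0 bB] := schwartz_real_lipschitz si.
exists (A + B) => [|t y]; first exact: addr_ge0.
rewrite (le_trans (cmod_le_Re_Im _)) // mulrDl lerD // raddfB.
- exact: bA.
- exact: bB.
Qed.

Lemma schwartz_continuous F : schwartz F ->
  continuous (fun t => complex.Re (F t)) /\ continuous (fun t => complex.Im (F t)).
Proof.
move=> [sr si]; have [A A0 bA] := schwartz_real_lipschitz sr.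
have [B B0 bB] := schwartz_real_lipschitz si.
by split; [exact: norm_increment_continuous A0 bA|exact: norm_increment_continuous B0 bB].
Qed.

Definition coord y (i : nat) : R := if insub i is Some j then y 0 j else 0.

Lemma coordE y (i : 'I_n) : coord y i = y 0 i.
Proof. by rewrite /coord valK. Qed.

Lemma coord0 i : coord 0 i = 0.
Proof. by rewrite /coord; case: insub => // j; rewrite mxE. Qed.

Lemma schwartz_real_mixed_lipschitz f N : schwartz_real f ->
  exists2 C : R, 0 <= C & forall y, mixed_lipschitz n (fun i x => decay N (x - coord y i)) C
    (fun s => Complex (f (rowOfSeq n s - y)) 0).
Proof.
move=> sf; have [A A0 bA] := schwartz_real_pder_bound N sf.
have pi1 : 1 <= 1 + pi :> R by rewrite lerDl pi_ge0.
exists (((1 + pi) ^+ N) ^+ n * A) => [|y].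
  by rewrite mulr_ge0 // !exprn_ge0 // (le_trans _ pi1).
have := @pder_bound_mixed_lipschitz (fun i x => decay N (x - coord y i)) ((1 + pi) ^+ N)
  _ _ _ n [::] (fun t => f (t - y)) A.
rewrite /= big_ord0 mulr1; apply => //.
- by rewrite exprn_ege1.
- by move=> i x; exact: decay_ge0.
- by move=> i; exact: slowly_varying_decay.
- by apply: smooth_translate; case: sf.
- move=> es es_n t; rewrite pder_translate; apply: le_trans (bA es es_n _) _.
  by rewrite ler_wpM2l // ler_prod // => i _; rewrite decay_ge0 coordE !mxE lexx.
Qed.

Lemma mixed_lipschitz_conjc k w C (b : seq R -> R[i]) :
  mixed_lipschitz k w C b -> mixed_lipschitz k w C (fun s => conjc (b s)).
Proof.
elim: k w C b => [|k IH] w C b /=; first by rewrite cmod_conjc.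
move=> [bs bd]; split=> [x|x h hpi]; first exact: IH.
by under [X in mixed_lipschitz _ _ _ X]eq_fun do rewrite -rmorphB; exact: IH (bd x h hpi).
Qed.

Lemma schwartz_mixed_lipschitz F N : schwartz F ->
  exists2 C : R, 0 <= C & forall y, mixed_lipschitz n (fun i x => decay N (x - coord y i)) C
    (fun s => F (rowOfSeq n s - y)).
Proof.
move=> [sr si]; have [A A0 bA] := schwartz_real_mixed_lipschitz N sr.
have [B B0 bB] := schwartz_real_mixed_lipschitz N si.
exists (A + B) => [|y]; first exact: addr_ge0.
have i1 : cmod (Complex 0 1 : R[i]) = 1 by rewrite /cmod /= expr0n expr1n add0r sqrtr1.
have := mixed_lipschitzD (bA y) (mixed_lipschitzZ (Complex 0 1) (bB y)).
rewrite i1 mul1r; congr mixed_lipschitz; apply/funext => s; exact/esym/complexE.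
Qed.

Definition window_product F G y s : R[i] := F (rowOfSeq n s) * conjc (G (rowOfSeq n s - y)).

(* By Peetre's inequality, half of the decay of [F] turns the decay of [G] around [y]
   into decay in [y]. *)
Lemma window_product_mixed_lipschitz F G : schwartz F -> schwartz G ->
  exists2 C : R, 0 <= C & forall y, mixed_lipschitz n (fun=> decay 2)
    (C * \prod_(i < n) decay 2 (y 0 i)) (window_product F G y).
Proof.
move=> sF sG; have [A A0 bA] := schwartz_mixed_lipschitz 4 sF.
have [B B0 bB] := schwartz_mixed_lipschitz 2 sG.
have K0 : 0 <= (1 + pi) ^+ 2 :> R by rewrite exprn_ge0 // addr_ge0 // pi_ge0.
have K1 : 0 <= (1 + (1 + pi) ^+ 2) ^+ n * (A * B) by rewrite !mulr_ge0 // exprn_ge0 // addr_ge0.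
exists ((1 + (1 + pi) ^+ 2) ^+ n * (A * B)) => // y.
under eq_bigr do rewrite -coordE.
have w0 N z (i : nat) (x : R) : 0 <= decay N (x - coord z i) by exact: decay_ge0.
have := mixed_lipschitzM A0 B0 K0 (w0 4 0) (w0 2 y) (fun i => @slowly_varying_decay _ 2 _)
  (bA 0) (mixed_lipschitz_conjc (bB y)).
under [X in mixed_lipschitz _ _ _ X]eq_fun do rewrite subr0.
apply: (@mixed_lipschitz_weight _ _ _ _ (fun i => decay 2 (coord y i))) => //.
- by move=> i x; rewrite mulr_ge0 ?w0.
- move=> i x; rewrite coord0 subr0 (decayD 2 2) -mulrA mulrC ler_wpM2r ?decay_ge0 //.
  exact: peetre_decay.
- by move=> i x; exact: decay_ge0.
- by move=> i; exact: decay_ge0.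
Qed.

End SchwartzBounds.

Section ShortTimeFourier.
Context {R : realType} {n : nat}.
Implicit Types (f gamma : 'rV[R]_n -> R[i]) (t x xi : 'rV[R]_n) (s : seq R) (rho : R).

Lemma cint_iter_cintegral (h : 'rV[R]_n -> R[i]) :
  iter_cintegrable n (fun s => h (rowOfSeq n s)) ->
  cint h = iter_cintegral n (fun s => h (rowOfSeq n s)).
Proof.
by move=> /iterint_Re_Im [hr hi]; rewrite /cint /intRn hr hi; case: (iter_cintegral _ _).
Qed.

Lemma stft_integrand f gamma x xi s :
  f (rowOfSeq n s) * conjc (expi (dotRn xi (rowOfSeq n s)) * gamma (rowOfSeq n s - x)) =
  window_product f gamma x s * character n (coord xi) s.
Proof.
have conjcM (a b : R[i]) : conjc (a * b) = conjc a * conjc b by exact: rmorphM.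
rewrite /window_product -mulrA conjcM; congr (_ * _).
rewrite mulrC conjc_expi; congr (_ * expi (- _)).
by apply: eq_bigr => i _; rewrite coordE mxE.
Qed.

Lemma stft_iter_cintegral f gamma x xi : schwartz f -> schwartz gamma ->
  let F s := window_product f gamma x s * character n (coord xi) s in
  iter_cintegrable n F /\ stft gamma f x xi = iter_cintegral n F.
Proof.
move=> sf sg F; have [C _ lipC] := window_product_mixed_lipschitz sf sg.
have [Fi _] := oscillation_boundP (coord xi) (lipC x).
have FE : (fun s => f (rowOfSeq n s) *
    conjc (expi (dotRn xi (rowOfSeq n s)) * gamma (rowOfSeq n s - x))) = F.
  by apply/funext => s; exact: stft_integrand.
by split=> //; rewrite /stft cint_iter_cintegral FE.
Qed.

Lemma stft_decay f gamma : schwartz f -> schwartz gamma -> exists2 M : R, 0 <= M &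
  forall x xi, cmod (stft gamma f x xi) <=
    M * (\prod_(i < n) decay 2 (x 0 i)) * \prod_(i < n) decay 1 (xi 0 i).
Proof.
move=> sf sg; have [C C0 lipC] := window_product_mixed_lipschitz sf sg.
exists (C * (4 * pi) ^+ n) => [|x xi]; first by rewrite mulr_ge0 // exprn_ge0 // mulr_ge0 // pi_ge0.
rewrite (stft_iter_cintegral x xi sf sg).2 [C * _ * _]mulrAC.
have -> : \prod_(i < n) decay 1 (xi 0 i) = \prod_(i < n) decay 1 (coord xi i).
  by apply: eq_bigr => i _; rewrite coordE.
exact: (oscillation_boundP _ (lipC x)).2.
Qed.

Lemma sum_norm_le_prod (I : Type) (r : seq I) (F : I -> R) :
  1 + \sum_(i <- r) `|F i| <= \prod_(i <- r) (1 + `|F i|).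
Proof.
elim: r => [|i r IH]; first by rewrite !big_nil addr0.
rewrite !big_cons; have : 0 <= \sum_(j <- r) `|F j| by exact: sumr_ge0.
by have := normr_ge0 (F i); nra.
Qed.

Lemma character_coord0 s : character n (coord (0 : 'rV[R]_n)) s = 1.
Proof.
by rewrite /character big1 ?oppr0 ?expi0 // => i _; rewrite coord0 mul0r.
Qed.

Lemma cmod_character_sub1_le (xi : nat -> R) s rho :
  (forall i : 'I_n, `|xi i| <= rho) ->
  cmod (character n xi s - 1) <= 2 * (rho * \sum_(i < n) `|nth 0 s i|).
Proof.
move=> xirho; rewrite (le_trans (cmod_expi_sub1_le _)) // ler_wpM2l // normrN mulr_sumr.
rewrite (le_trans (ler_norm_sum _ _ _)) // ler_sum // => i _.
by rewrite normrM ler_wpM2r.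
Qed.

Lemma stft_near_origin f gamma : schwartz f -> schwartz gamma -> exists2 D : R, 0 <= D &
  forall rho x xi, 0 <= rho -> (forall i, `|x 0 i| <= rho) -> (forall i, `|xi 0 i| <= rho) ->
    cmod (stft gamma f x xi - stft gamma f 0 0) <= D * rho.
Proof.
move=> sf sg; have [A A0 fA] := schwartz_decay 3 sf; have [B B0 gB] := schwartz_decay 0 sg.
have [L L0 gL] := schwartz_lipschitz sg.
have AB0 : 0 <= A * (2 * B + L * n%:R) by rewrite mulr_ge0 // addr_ge0 // mulr_ge0.
exists (4 ^+ n * (A * (2 * B + L * n%:R))) => [|rho x xi rho0 xrho xirho].
  by rewrite mulr_ge0 // exprn_ge0.
have [Fi ->] := stft_iter_cintegral x xi sf sg; have [Fi0 ->] := stft_iter_cintegral 0 0 sf sg.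
rewrite -iter_cintegralB // -mulrA; apply: cmod_iter_cintegral_le => [||s sz].
- by rewrite mulr_ge0.
- exact: iter_cintegrableB.
set t := rowOfSeq n s; pose P := \prod_(i < n) (1 + `|nth 0 s i|).
have P1 : 1 + \sum_(i < n) `|nth 0 s i| <= P := sum_norm_le_prod _ _.
have sum0 : 0 <= \sum_(i < n) `|nth 0 s i| by exact: sumr_ge0.
have split_difference : window_product f gamma x s * character n (coord xi) s -
    window_product f gamma 0 s * character n (coord (0 : 'rV[R]_n)) s =
    f t * (conjc (gamma (t - x)) * (character n (coord xi) s - 1) +
      conjc (gamma (t - x) - gamma t)).
  by rewrite character_coord0 /window_product subr0 (rmorphB conjc) -/t; ring.
have phase : cmod (conjc (gamma (t - x)) * (character n (coord xi) s - 1)) <= B * (2 * (rho * P)).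
  rewrite cmodM cmod_conjc ler_pM ?cmod_ge0 //.
    by rewrite (le_trans (gB _)) // ler_piMr // prod_decay_le1.
  rewrite (le_trans (cmod_character_sub1_le (rho := rho) _ _)) // => [i|].
    by rewrite coordE.
  by rewrite ler_wpM2l // ler_wpM2l //; lra.
have translation : cmod (conjc (gamma (t - x) - gamma t)) <= L * (n%:R * rho * P).
  rewrite cmod_conjc (le_trans (gL _ _)) // ler_wpM2l //.
  rewrite (@le_trans _ _ (n%:R * rho)) //; last by rewrite ler_peMr ?mulr_ge0 //; lra.
  rewrite mulr_natl -[n in leRHS]card_ord -sumr_const ler_sum // => i _.
  by rewrite mxE normrN.
have decayP : \prod_(i < n) decay 2 (nth 0 s i) = (\prod_(i < n) decay 3 (nth 0 s i)) * P.
  rewrite /P -big_split /=; apply: eq_bigr => i _.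
  by rewrite (decayD 2 1) -mulrA decay1_mul mulr1.
rewrite split_difference cmodM decayP.
apply: (@le_trans _ _ (A * (\prod_(i < n) decay 3 (nth 0 s i)) *
    (B * (2 * (rho * P)) + L * (n%:R * rho * P)))); last by lra.
apply: ler_pM; rewrite ?cmod_ge0 //; last by rewrite (le_trans (ler_cmodD _ _)) // lerD.
by apply: le_trans (fA _) _; under eq_bigr do rewrite mxE.
Qed.

Lemma stft_origin_gt0 gamma : schwartz gamma -> (exists t, gamma t != 0) ->
  0 < complex.Re (stft gamma gamma 0 0).
Proof.
move=> sg [t0 gt0]; have [Fi ->] := stft_iter_cintegral 0 0 sg sg.
have [L L0 gL] := schwartz_lipschitz sg.
rewrite -lte_fin -(iterint_Re_Im Fi).1.
have energyE s : complex.Re (window_product gamma gamma 0 s *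
    character n (coord (0 : 'rV[R]_n)) s) = cmod (gamma (rowOfSeq n s)) ^+ 2.
  rewrite character_coord0 mulr1 /window_product subr0 sqr_cmod.
  by case: (gamma _) => a b /=; rewrite mulrN opprK.
pose a := cmod (gamma t0); have a0 : 0 < a := cmod_gt0 gt0.
have L1 : 0 < 2 * (L * n%:R + 1) by rewrite mulr_gt0 // ltr_pwDr // mulr_ge0.
pose d := a / (2 * (L * n%:R + 1)); have d0 : 0 < d by rewrite divr_gt0.
apply: (lt_le_trans _ (@iterint_ge_box _ n _ (fun i => coord t0 i - d) (fun i => coord t0 i + d)
  ((a / 2) ^+ 2) _ _ _ _)).
- by rewrite lte_fin mulr_gt0 ?exprn_gt0 ?divr_gt0 // prodr_gt0 // => i _; lra.
- by move=> i; lra.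
- exact: sqr_ge0.
- by move=> s; rewrite lee_fin energyE sqr_ge0.
move=> s sz box; rewrite lee_fin energyE.
apply: lerXn2r; rewrite ?nnegrE ?cmod_ge0 ?divr_ge0 ?(ltW a0) //.
have near_peak : L * \sum_(i < n) `|(rowOfSeq n s - t0) 0 i| <= a / 2.
  apply: (@le_trans _ _ (L * \sum_(i < n) d)).
    rewrite ler_wpM2l // ler_sum // => i _; rewrite !mxE ler_distl.
    by have := box i (ltn_ord i); rewrite coordE.
  rewrite sumr_const card_ord -[d *+ _]mulr_natr mulrCA /d mulrAC ler_pdivrMr //.
  by lra.
have := gL t0 (rowOfSeq n s - t0); rewrite subrKC => /le_trans/(_ near_peak).
have := lerB_cmodD (gamma t0) (gamma (rowOfSeq n s) - gamma t0).
by rewrite subrKC -/a; lra.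
Qed.

Lemma stft_ge_near_origin gamma : schwartz gamma -> (exists t, gamma t != 0) ->
  exists c r : R, [/\ 0 < c, 0 < r & forall x xi, (forall i, `|x 0 i| <= r) ->
    (forall i, `|xi 0 i| <= r) -> c <= cmod (stft gamma gamma x xi)].
Proof.
move=> sg g0; have k0 := stft_origin_gt0 sg g0; set k := complex.Re _ in k0.
have [D D0 near_origin] := stft_near_origin sg sg.
have D1 : 0 < 2 * (D + 1) by lra.
exists (k / 2), (k / (2 * (D + 1))); split=> [||x xi xr xir]; rewrite ?divr_gt0 //.
have r0 : 0 <= k / (2 * (D + 1)) by rewrite divr_ge0 ?ltW.
have Dr : D * (k / (2 * (D + 1))) <= k / 2.
  by rewrite mulrA ler_pdivrMr //; nra.
have := le_trans (near_origin _ x xi r0 xr xir) Dr.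
have : k <= cmod (stft gamma gamma 0 0) by rewrite (le_trans _ (normr_Re_le _)) // ler_norm.
have := lerB_cmodD (stft gamma gamma 0 0) (stft gamma gamma x xi - stft gamma gamma 0 0).
by rewrite subrKC; lra.
Qed.

End ShortTimeFourier.

Section CoordinateMultipliers.
Context {R : realType} {m : nat}.
Local Notation rV := 'rV[R]_m.+1.
Implicit Types (f gamma : rV -> R[i]) (u v : R -> R[i]) (x xi : rV) (S : seq (R[i] * R)) (c : R).
Local Notation "''e_0'" := (delta_mx 0 0 : rV).

Definition coord_mult u f : rV -> R[i] := fun t => u (t 0 0) * f t.

Lemma schwartz_coord_mult_trig S f : schwartz f -> schwartz (coord_mult (trig S) f).
Proof.
move=> sf; elim: S => [|b S IH].
  have := schwartz_linear (-1) sf sf; congr schwartz; apply/funext => t.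
  by rewrite /coord_mult trig_nil mul0r mulN1r addNr.
have := schwartz_linear b.1 (schwartz_expiM b.2 0 sf) IH; congr schwartz; apply/funext => t.
by rewrite /coord_mult trig_cons mulrDl mulrA.
Qed.

Definition stft_slice gamma f x xi : R -> R[i] :=
  partial_transform m (fun i => coord xi i.+1) (window_product f gamma x).

Lemma stft_slice_cdecay gamma f x xi : schwartz f -> schwartz gamma ->
  cdecay (stft_slice gamma f x xi).
Proof.
move=> sf sg; have [C _ lipC] := window_product_mixed_lipschitz sf sg.
exact: lipschitz_decay_cdecay (lipschitz_partial_transform (@oscillation_boundP _ _) _ (lipC x)).
Qed.

Lemma stft_coord_multE gamma f u c x xi : schwartz f -> schwartz gamma ->
  ccontinuous u -> (forall r, cmod (u r) <= c) ->
  stft gamma (coord_mult u f) x xi =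
  cintegral (fun r => u r * (expi (- xi 0 0 * r) * stft_slice gamma f x xi r)).
Proof.
move=> sf sg cu uc; have [C _ lipC] := window_product_mixed_lipschitz sf sg.
have [Fi E] := iter_cintegral_mul_head (@oscillation_boundP _ _) (coord xi) (lipC x) cu uc.
have FE : (fun s => u (head 0 s) * (window_product f gamma x s * character m.+1 (coord xi) s)) =
    (fun s => (fun t => coord_mult u f t * conjc (expi (dotRn xi t) * gamma (t - x)))
      (rowOfSeq m.+1 s)).
  by apply/funext => s; rewrite -stft_integrand /coord_mult mxE nth0 mulrA.
by rewrite /stft cint_iter_cintegral -FE // E (coordE xi 0).
Qed.

Lemma coord_sub_first xi c i : coord (xi - c *: 'e_0) i.+1 = coord xi i.+1.
Proof.
rewrite /coord; case: insubP => // j _ jE; rewrite !mxE.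
have -> : (j == 0) = false by apply/eqP => j0; move: jE; rewrite j0.
by rewrite andbF mulr0 subr0.
Qed.

Lemma stft_coord_multD gamma f u v c (d : R) x xi : schwartz f -> schwartz gamma ->
  ccontinuous u -> ccontinuous v -> (forall r, cmod (u r) <= c) -> (forall r, cmod (v r) <= d) ->
  stft gamma (coord_mult (fun r => u r + v r) f) x xi =
  stft gamma (coord_mult u f) x xi + stft gamma (coord_mult v f) x xi.
Proof.
move=> sf sg cu cv uc vd.
have uvcd r : cmod (u r + v r) <= c + d by rewrite (le_trans (ler_cmodD _ _)) // lerD.
rewrite (stft_coord_multE _ _ sf sg (ccontinuousD cu cv) uvcd).
rewrite (stft_coord_multE _ _ sf sg cu uc) (stft_coord_multE _ _ sf sg cv vd).
have slice_decay := cdecay_expiM (- xi 0 0) (stft_slice_cdecay x xi sf sg).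
rewrite -cintegralD.
- by congr cintegral; apply/funext => r; rewrite mulrDl.
- exact/cdecay_integrable/(cdecayM cu uc).
- exact/cdecay_integrable/(cdecayM cv vd).
Qed.

Lemma stft_coord_mult_expi gamma f (a : R[i]) c x xi : schwartz f -> schwartz gamma ->
  stft gamma (coord_mult (fun r => a * expi (c * r)) f) x xi =
  a * stft gamma f x (xi - c *: 'e_0).
Proof.
move=> sf sg; have cu := ccontinuousM (ccontinuous_cst a) (ccontinuous_expi c).
have u_le r : cmod (a * expi (c * r)) <= cmod a by rewrite cmodM cmod_expi mulr1.
have one_le : cmod (1 : R[i]) <= 1 by rewrite -(@expi0 R) cmod_expi.
have {2}-> : f = coord_mult (fun=> 1) f by apply/funext => t; rewrite /coord_mult mul1r.
rewrite (stft_coord_multE _ _ sf sg cu u_le).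
rewrite (stft_coord_multE _ _ sf sg (ccontinuous_cst 1) (fun=> one_le)) -cintegralZ.
  congr cintegral; apply/funext => r; rewrite mul1r -mulrA; congr (_ * _).
  rewrite mulrA -expiD !mxE /= mulr1; congr (expi _ * partial_transform _ _ _ _); first by ring.
  by apply/funext => i; rewrite coord_sub_first.
under eq_fun do rewrite mul1r.
exact/cdecay_integrable/cdecay_expiM/stft_slice_cdecay.
Qed.

Lemma stft_coord_mult_trig gamma f S x xi : schwartz f -> schwartz gamma ->
  stft gamma (coord_mult (trig S) f) x xi =
  \sum_(b <- S) b.1 * stft gamma f x (xi - b.2 *: 'e_0).
Proof.
move=> sf sg; elim: S => [|b S IH].
  have := stft_coord_mult_expi 0 0 x xi sf sg; rewrite mul0r big_nil; congr (_ = _).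
  by congr stft; apply/funext => t; rewrite /coord_mult trig_nil mul0r.
have -> : trig (b :: S) = (fun r => b.1 * expi (b.2 * r) + trig S r).
  by apply/funext => r; rewrite trig_cons.
rewrite (@stft_coord_multD _ _ _ _ (cmod b.1) (l1norm S)) //.
- by rewrite stft_coord_mult_expi // big_cons IH.
- exact: ccontinuousM (ccontinuous_cst _) (ccontinuous_expi _).
- exact: ccontinuous_trig.
- by move=> r; rewrite cmodM cmod_expi mulr1.
- exact: cmod_trig_le.
Qed.

Lemma stft_coord_mult_le gamma f : schwartz f -> schwartz gamma -> exists2 M : R, 0 <= M &
  forall u c x xi, ccontinuous u -> (forall r, cmod (u r) <= c) ->
    cmod (stft gamma (coord_mult u f) x xi) <= M * c.
Proof.
move=> sf sg; have [C C0 lipC] := window_product_mixed_lipschitz sf sg.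
have M0 : 0 <= C * (4 * pi) ^+ m by rewrite mulr_ge0 // exprn_ge0 // mulr_ge0 // pi_ge0.
exists (4 * (C * (4 * pi) ^+ m)) => [|u c x xi cu uc]; first by rewrite mulr_ge0.
rewrite (stft_coord_multE _ _ sf sg cu uc) -mulrA.
have slice_decay := cdecay_expiM (- xi 0 0) (stft_slice_cdecay x xi sf sg).
apply: cmod_cintegral_le; first exact/cdecay_integrable/(cdecayM cu uc).
move=> r; rewrite !cmodM cmod_expi mul1r [_ * c]mulrC -mulrA ler_pM ?cmod_ge0 //.
have [slice_le _] := lipschitz_partial_transform (@oscillation_boundP _ _)
  (fun i => coord xi i.+1) (lipC x).
apply: le_trans (slice_le r) _; rewrite ler_wpM2r ?decay_ge0 //.
rewrite -[leRHS]mulr1 ler_pM ?prod_decay_ge0 ?prod_decay_le1 //.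
  by rewrite !mulr_ge0 ?prod_decay_ge0 ?exprn_ge0 // mulr_ge0 // pi_ge0.
rewrite ler_wpM2r ?exprn_ge0 ?mulr_ge0 ?pi_ge0 //.
by rewrite ler_piMr // prod_decay_le1.
Qed.

End CoordinateMultipliers.

Section SeparatedBoxes.
Context {R : realType}.
Let mu := @lebesgue_measure R.
Implicit Types (Lam : seq R) (r c y : R) (m : nat).

Definition sum_indic_itv Lam r y : R :=
  \sum_(lam <- Lam) \1_(`[lam - r, lam + r]%classic : set R) y.

Lemma sum_indic_itv_ge0 Lam r y : 0 <= sum_indic_itv Lam r y.
Proof. exact: sumr_ge0. Qed.

Lemma measurable_sum_indic_itv Lam r :
  measurable_fun [set: measurableTypeR R] (sum_indic_itv Lam r).
Proof. by apply: measurable_sum => lam; exact: measurable_indic. Qed.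

Lemma integral_sum_indic_itv Lam r : 0 <= r ->
  (\int[mu]_y (sum_indic_itv Lam r y)%:E = ((size Lam)%:R * (2 * r))%:E)%E.
Proof.
move=> r0; under eq_integral do rewrite -sumEFin.
rewrite ge0_integral_sum //; last first.
  by move=> lam; apply/measurable_EFinP; exact: measurable_indic.
rewrite (eq_bigr (fun=> (2 * r)%:E)) => [|lam _].
  rewrite sumEFin big_const_seq count_predT iter_addr_0; congr EFin.
  by rewrite -[LHS]mulr_natl.
by rewrite integral_indic_itv; [congr EFin; ring|lra].
Qed.

Lemma sum_indic_itv_eq0 Lam r y : {in Lam, forall lam, r < `|y - lam|} ->
  sum_indic_itv Lam r y = 0.
Proof.
move=> far; rewrite /sum_indic_itv big_seq big1 // => lam /far.
rewrite ltNge => /negP ylam; rewrite indicE memNset //= in_itv /=.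
by rewrite -ler_distl.
Qed.

Lemma sum_indic_itv_le1 Lam r y : uniq Lam ->
  {in Lam &, forall l1 l2, l1 != l2 -> 2 * r < `|l1 - l2|} -> sum_indic_itv Lam r y <= 1.
Proof.
move=> uL sep.
have [/hasP[lam lamL ylam]|/hasPn far] := boolP (has (fun lam => `|y - lam| <= r) Lam).
  rewrite /sum_indic_itv (bigD1_seq lam) //= big_seq_cond big1 ?addr0 ?indicE ?lern1 ?leq_b1 //.
  move=> lam' /andP[lam'L lam'lam]; rewrite indicE memNset //= in_itv /= -ler_distl => ylam'.
  by have := sep _ _ lam'L lamL lam'lam; have := ler_distD y lam' lam; rewrite (distrC lam' y); lra.
by rewrite sum_indic_itv_eq0 // => lam /far; rewrite -ltNge.
Qed.

Lemma iterint_ge_separated_boxes m (F : seq R -> \bar R) Lam r c : 0 <= r -> 0 <= c -> uniq Lam ->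
  {in Lam &, forall l1 l2, l1 != l2 -> 2 * r < `|l1 - l2|} -> (forall s, 0 <= F s)%E ->
  (forall s lam, size s = m.+1 -> lam \in Lam -> `|nth 0 s 0 - lam| <= r ->
     (forall i, (i < m)%N -> `|nth 0 s i.+1| <= r) -> (c%:E <= F s)%E) ->
  ((c * (size Lam)%:R * (2 * r) ^+ m.+1)%:E <= iterint m.+1 F)%E.
Proof.
move=> r0 c0 uL sep F0 cF.
pose g (i : nat) : R -> R := if i is 0 then sum_indic_itv Lam r else \1_(`[- r, r]%classic : set R).
pose I (i : nat) : R := if i is 0 then (size Lam)%:R * (2 * r) else 2 * r.
have g0 i y : 0 <= g i y by case: i => [|i] //; exact: sum_indic_itv_ge0.
rewrite (_ : c * _ * _ = c * \prod_(i < m.+1) I i); last first.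
  by rewrite big_ord_recl /= prodr_const card_ord exprS; ring.
rewrite -(@iterint_prod _ _ g) //; last 2 first.
- by move=> [|i] /=; [exact: measurable_sum_indic_itv|exact: measurable_indic].
- move=> [|i] /=; first exact: integral_sum_indic_itv.
  by rewrite integral_indic_itv; [congr EFin; ring|lra].
apply: iterint_le => [s|s sz]; first by rewrite lee_fin mulr_ge0 // prodr_ge0.
have [/forallP small|/forallPn [i si]] := boolP [forall i : 'I_m, `|nth 0 s i.+1| <= r]; last first.
  move: si; rewrite ler_norml => /negP si; rewrite (bigD1 (lift ord0 i)) //= /bump /= add1n.
  by rewrite indicE memNset ?mul0r ?mulr0 //= in_itv.
have [/hasP[lam lamL slam]|/hasPn far] := boolP (has (fun lam => `|nth 0 s 0 - lam| <= r) Lam).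
  apply: le_trans (cF s lam sz lamL slam (fun i im => small (Ordinal im))).
  rewrite lee_fin ler_piMr // big_ord_recl -[leRHS]mulr1 ler_pM ?g0 ?prodr_ge0 //.
    exact: sum_indic_itv_le1.
  by apply: prodr_ile1 => i _; rewrite g0 /= indicE ?lern1 ?leq_b1.
rewrite big_ord_recl /= sum_indic_itv_eq0 ?mul0r ?mulr0 // => lam /far.
by rewrite -ltNge.
Qed.

End SeparatedBoxes.

Section ModulationNorm.
Context {R : realType} {n : nat}.
Let mu := @lebesgue_measure R.
Implicit Types (f gamma : 'rV[R]_n -> R[i]) (h : 'rV[R]_n -> R) (x xi : 'rV[R]_n) (p q r c : R).

Definition Lp_norm p h : \bar R := poweR (intRn (fun x => (h x `^ p)%:E)) p^-1.

Lemma intRn_powR_ge0 p h : (0 <= intRn (fun x => (h x `^ p)%:E))%E.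
Proof. by apply: iterint_ge0 => s; rewrite lee_fin powR_ge0. Qed.

Lemma ge0_ler_poweR (a b : \bar R) r : 0 <= r -> (0 <= a)%E -> (a <= b)%E ->
  (poweR a r <= poweR b r)%E.
Proof.
move=> r0 a0 ab; apply: gt0_ler_poweR => //; rewrite in_itv /= ?leey ?andbT //.
exact: le_trans a0 ab.
Qed.

Lemma powR_mul_invr c (W : R) p : 0 <= c -> 0 <= W -> 0 < p ->
  (c `^ p * W) `^ p^-1 = c * W `^ p^-1.
Proof.
by move=> c0 W0 p0; rewrite powRM ?powR_ge0 // -powRrM divff ?gt_eqF // powRr1.
Qed.

Lemma Lp_norm_le_decay p h c : 1 <= p -> 0 <= c -> (forall x, 0 <= h x) ->
  (forall x, h x <= c * \prod_(i < n) decay 2 (x 0 i)) ->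
  (Lp_norm p h <= (c * (2 ^+ n) `^ p^-1)%:E)%E.
Proof.
move=> p1 c0 h0 hc; have p0 : 0 < p by lra.
rewrite /Lp_norm -powR_mul_invr ?exprn_ge0 // -poweR_EFin.
apply: ge0_ler_poweR; [by rewrite invr_ge0 ltW|exact: intRn_powR_ge0|].
have -> : 2 ^+ n = \prod_(i < n) 2 :> R by rewrite prodr_const card_ord.
rewrite -(@iterint_prod R n (fun=> decay 2) (fun=> 2)).
- apply: iterint_le => [s|s sz]; rewrite lee_fin ?powR_ge0 //.
  have P0 := @prod_decay_ge0 R _ (index_enum 'I_n) 2 (fun i => nth 0 s i).
  apply: (@le_trans _ _ ((c * \prod_(i < n) decay 2 (nth 0 s i)) `^ p)).
    apply: ge0_ler_powR; rewrite ?nnegrE ?mulr_ge0 ?(ltW p0) //.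
    by apply: le_trans (hc _) _; under eq_bigr do rewrite mxE.
  rewrite powRM // ler_wpM2l ?powR_ge0 // ge1r_powR // prod_decay_le1 andbT prodr_gt0 // => i _.
  exact: decay_gt0.
- by move=> i; apply: continuous_measurable_fun; exact: decay_continuous.
- by move=> i x; exact: decay_ge0.
- by move=> i; exact: integral_decay2.
- exact: powR_ge0.
Qed.

Lemma Lp_norm_ge_box p h c r : 0 < p -> 0 <= c -> 0 <= r ->
  (forall x, (forall i, `|x 0 i| <= r) -> c <= h x) ->
  ((c * ((2 * r) ^+ n) `^ p^-1)%:E <= Lp_norm p h)%E.
Proof.
move=> p0 c0 r0 ch; have r20 : 0 <= (2 * r) ^+ n by rewrite exprn_ge0 // mulr_ge0.
rewrite /Lp_norm -powR_mul_invr // -poweR_EFin.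
apply: ge0_ler_poweR; [by rewrite invr_ge0 ltW|by rewrite lee_fin mulr_ge0 ?powR_ge0|].
have -> : (2 * r) ^+ n = \prod_(i < n) (r - - r).
  by rewrite prodr_const card_ord; congr (_ ^+ _); ring.
apply: (@iterint_ge_box _ n _ (fun=> - r) (fun=> r)) => [_|||s sz box].
- by lra.
- exact: powR_ge0.
- by move=> s; rewrite lee_fin powR_ge0.
have ch_s : c <= h (rowOfSeq n s) by apply: ch => i; rewrite mxE ler_norml; exact: box.
by rewrite lee_fin; apply: ge0_ler_powR; rewrite ?nnegrE ?(ltW p0) ?(le_trans c0).
Qed.

Lemma modnorm_le_prod gamma p q f (B : 'rV[R]_n -> R) c (g : nat -> R -> R) (I : nat -> R) :
  1 <= p -> 0 < q ->
  (forall x xi, cmod (stft gamma f x xi) <= B xi * \prod_(i < n) decay 2 (x 0 i)) ->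
  (forall xi, 0 <= B xi) -> 0 <= c ->
  (forall xi, B xi `^ q <= c * \prod_(i < n) g i (xi 0 i)) ->
  (forall i, measurable_fun [set: measurableTypeR R] (g i)) -> (forall i y, 0 <= g i y) ->
  (forall i, (\int[mu]_y (g i y)%:E)%E = (I i)%:E) ->
  (modnorm gamma p q f <= (((2 ^+ n) `^ (q / p) * c * \prod_(i < n) I i) `^ q^-1)%:E)%E.
Proof.
move=> p1 q0 VB B0 c0 Bg mg g0 gI; rewrite /modnorm -poweR_EFin.
apply: ge0_ler_poweR; first by rewrite invr_ge0 ltW.
  by apply: iterint_ge0 => s; exact: poweR_ge0.
rewrite -(@iterint_prod R n g I) //; last by rewrite mulr_ge0 ?powR_ge0.
apply: iterint_le => [s|s sz]; first exact: poweR_ge0.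
set xi := rowOfSeq n s.
have inner := Lp_norm_le_decay p1 (B0 xi) (fun x => cmod_ge0 _) (VB^~ xi).
apply: le_trans (ge0_ler_poweR (ltW q0) (poweR_ge0 _ _) inner) _.
rewrite poweR_EFin lee_fin powRM ?powR_ge0 // -powRrM mulrC [p^-1 * q]mulrC -mulrA.
rewrite ler_wpM2l ?powR_ge0 // (le_trans (Bg xi)) //.
by under eq_bigr do rewrite mxE.
Qed.

Lemma powR_prod (I : Type) (l : seq I) (F : I -> R) q : (forall i, 0 <= F i) ->
  (\prod_(i <- l) F i) `^ q = \prod_(i <- l) F i `^ q.
Proof.
move=> F0; elim: l => [|i l IH]; first by rewrite !big_nil powR1.
by rewrite !big_cons powRM ?IH // prodr_ge0.
Qed.

Lemma modnorm_schwartz_lty gamma f p q : schwartz gamma -> schwartz f -> 1 <= p -> 1 < q ->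
  exists B : R, (modnorm gamma p q f <= B%:E)%E.
Proof.
move=> sg sf p1 q1; have [M M0 VM] := stft_decay sf sg.
pose B xi := M * \prod_(i < n) decay 1 (xi 0 i).
have B0 xi : 0 <= B xi by rewrite mulr_ge0 // prod_decay_ge0.
eexists; apply: (@modnorm_le_prod gamma p q f B (M `^ q) (fun _ y => decay 1 y `^ q) _ p1) => //.
- by lra.
- by move=> x xi; rewrite /B mulrAC.
- exact: powR_ge0.
- move=> xi; rewrite powRM ?prod_decay_ge0 // powR_prod // => i.
  exact: decay_ge0.
- by move=> i; apply: continuous_measurable_fun; exact: decay_powR_continuous.
- by move=> i y; exact: powR_ge0.
- by move=> i; exact: integral_decay1_powR.
Qed.

End ModulationNorm.

Lemma modnorm_ge_separated_boxes (R : realType) (m : nat) (gamma f : 'rV[R]_m.+1 -> R[i])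
    (p q r c : R) (Lam : seq R) : 0 < p -> 0 < q -> 0 <= r -> 0 <= c -> uniq Lam ->
  {in Lam &, forall l1 l2, l1 != l2 -> 2 * r < `|l1 - l2|} ->
  (forall (x xi : 'rV_m.+1) lam, lam \in Lam -> (forall i, `|x 0 i| <= r) ->
     (forall i, `|(xi - lam *: delta_mx 0 0) 0 i| <= r) -> c <= cmod (stft gamma f x xi)) ->
  (((((2 * r) ^+ m.+1) `^ (q / p) * (2 * r) ^+ m.+1 * c `^ q * (size Lam)%:R) `^ q^-1)%:E <=
     modnorm gamma p q f)%E.
Proof.
move=> p0 q0 r0 c0 uL sep cV; have r20 : 0 <= (2 * r) ^+ m.+1 by rewrite exprn_ge0 // mulr_ge0.
rewrite /modnorm -poweR_EFin; apply: ge0_ler_poweR; first by rewrite invr_ge0 ltW.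
  by rewrite lee_fin !mulr_ge0 ?powR_ge0.
rewrite (_ : _ * _ = (c * ((2 * r) ^+ m.+1) `^ p^-1) `^ q * (size Lam)%:R * (2 * r) ^+ m.+1);
  last by rewrite powRM ?powR_ge0 // -powRrM [p^-1 * q]mulrC; ring.
apply: iterint_ge_separated_boxes => // [|s|s lam sz lamL slam small].
- exact: powR_ge0.
- exact: poweR_ge0.
set xi := rowOfSeq m.+1 s.
have box_xi i : `|(xi - lam *: delta_mx 0 0) 0 i| <= r.
  rewrite !mxE; case: i => [[|i] im].
    by rewrite eqxx mulr1.
  by rewrite -val_eqE /= mulr0 subr0; apply: small.
have inner := Lp_norm_ge_box p0 c0 r0 (fun x xr => cV x xi lam lamL xr box_xi).
rewrite -poweR_EFin; apply: ge0_ler_poweR inner; first exact: ltW.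
by rewrite lee_fin mulr_ge0 ?powR_ge0.
Qed.

Section SeparatedFrequencies.
Context {R : realType}.
Let mu := @lebesgue_measure R.
Implicit Types (S : seq (R[i] * R)) (D L c q s y : R).

Lemma powR_sum_le (I : Type) (r : seq I) (F : I -> R) s : 1 < s -> (forall i, 0 <= F i) ->
  (\sum_(i <- r) F i) `^ s <= (size r)%:R `^ (s - 1) * \sum_(i <- r) F i `^ s.
Proof.
move=> s1 F0; have s0 : 0 < s by lra.
case: r => [|i0 r']; first by rewrite !big_nil mulr0 powR0 // gt_eqF.
set r := i0 :: r'; set N : R := (size r)%:R; have N0 : 0 < N by rewrite ltr0n.
pose m : R := (\sum_(i <- r) F i) / N.
have m0 : 0 <= m by rewrite divr_ge0 ?sumr_ge0 // ltW.
have sumE : \sum_(i <- r) F i = N * m by rewrite mulrC divfK // gt_eqF.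
have conj : s^-1 + (s / (s - 1))^-1 = 1 by field; lra.
have young i : F i * m `^ (s - 1) <= F i `^ s / s + m `^ s / (s / (s - 1)).
  have := conjugate_powR (F0 i) (powR_ge0 m (s - 1)) s0 _ conj; rewrite -powRrM.
  rewrite (_ : (s - 1) * (s / (s - 1)) = s); last by field; lra.
  by apply; rewrite divr_gt0 //; lra.
have : \sum_(i <- r) F i * m `^ (s - 1) <= \sum_(i <- r) (F i `^ s / s + m `^ s / (s / (s - 1))).
  exact: ler_sum.
rewrite -mulr_suml big_split /= -mulr_suml big_const_seq count_predT iter_addr_0.
rewrite -[m `^ s / _ *+ _]mulr_natl -/N sumE -mulrA mulr_powRB1 // => sum_young.
have means : N * m `^ s <= \sum_(i <- r) F i `^ s.
  rewrite -(ler_pM2r (x := s^-1)) ?invr_gt0 //.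
  have : m `^ s / (s / (s - 1)) = m `^ s - m `^ s / s by field; lra.
  move=> E; rewrite E in sum_young; lra.
rewrite powRM ?(ltW N0) // -(mulr_powRB1 (ltW N0) s0) mulrAC mulrC.
by rewrite ler_wpM2l ?powR_ge0.
Qed.

Definition sum_decay S y : R := \sum_(b <- S) decay 1 (y - b.2).

Lemma sum_decay_ge0 S y : 0 <= sum_decay S y.
Proof. by apply: sumr_ge0 => b _; exact: decay_ge0. Qed.

Lemma sum_decay_far_le S D y : 0 < D -> {in S, forall b, D <= `|y - b.2|} ->
  sum_decay S y <= (size S)%:R / D.
Proof.
move=> D0 far; rewrite /sum_decay big_seq.
apply: (@le_trans _ _ (\sum_(b <- S | b \in S) D^-1)).
  by apply: ler_sum => b /far; exact: decay1_le.
by rewrite -big_seq big_const_seq count_predT iter_addr_0 mulr_natl.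
Qed.

Lemma sum_decay_separated_le S L y : 0 < L -> (size S)%:R <= L -> separated L S ->
  sum_decay S y <= 3.
Proof.
move=> L0 SL sep; have L2 : 0 < L / 2 by rewrite divr_gt0.
have ratio (N : nat) : (N <= size S)%N -> N%:R / (L / 2) <= 2 :> R.
  move=> NS; rewrite ler_pdivrMr // [2 * _]mulrC divfK //.
  by rewrite (le_trans _ SL) // ler_nat.
have [/hasP[b bS yb]|/hasPn far] := boolP (has (fun b => `|y - b.2| < L / 2) S); last first.
  rewrite (le_trans (sum_decay_far_le L2 _)) // => [b /far|]; first by rewrite -leNgt.
  by rewrite (le_trans (ratio _ _)) // ler_nat.
rewrite /sum_decay (big_rem b) //= (_ : 3 = 1 + 2); last by ring.
rewrite lerD ?decay_le1 // (le_trans (sum_decay_far_le L2 _)) // => [b' b'S|].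
  have := sep b bS b' b'S; have := ler_distD y b.2 b'.2; rewrite (distrC b.2 y); lra.
by rewrite ratio // size_rem // leq_pred.
Qed.

Lemma sum_decay_powR_le S L q s y : 1 < s -> s < q -> 0 < L -> (size S)%:R <= L ->
  separated L S -> sum_decay S y `^ q <=
    3 `^ (q - s) * ((size S)%:R `^ (s - 1) * \sum_(b <- S) decay 1 (y - b.2) `^ s).
Proof.
move=> s1 sq L0 SL sep.
have -> : sum_decay S y `^ q = sum_decay S y `^ (q - s) * sum_decay S y `^ s.
  by rewrite -powRD ?subrK // gt_eqF //; lra.
apply: ler_pM; rewrite ?powR_ge0 //; last by apply: powR_sum_le => // b; exact: decay_ge0.
apply: ge0_ler_powR; rewrite ?nnegrE ?sum_decay_ge0 //; first by lra.
exact: sum_decay_separated_le sep.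
Qed.

Lemma measurable_decay_powR s c :
  measurable_fun [set: measurableTypeR R] (fun y => decay 1 (y - c) `^ s).
Proof.
apply: continuous_measurable_fun.
exact: (continuous_translate (f := fun y => decay 1 y `^ s) (@decay_powR_continuous _ 1 s)).
Qed.

Lemma integral_sum_decay_powR S s : 1 < s ->
  (\int[mu]_y (\sum_(b <- S) decay 1 (y - b.2) `^ s)%:E = ((size S)%:R * (2 / (s - 1)))%:E)%E.
Proof.
move=> s1; under eq_integral do rewrite -sumEFin.
rewrite ge0_integral_sum //; last 2 first.
- by move=> b; apply/measurable_EFinP; exact: measurable_decay_powR.
- by move=> b y _; rewrite lee_fin powR_ge0.
rewrite (eq_bigr (fun=> (2 / (s - 1))%:E)) => [|b _].
  rewrite sumEFin big_const_seq count_predT iter_addr_0; congr EFin.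
  by rewrite -[LHS]mulr_natl.
rewrite (@integral_translate R (fun y => decay 1 y `^ s)).
  exact: integral_decay1_powR.
exact: decay_powR_continuous.
Qed.

End SeparatedFrequencies.

Section ModulationNormOfTrigonometricMultiples.
Context {R : realType} {m : nat}.
Local Notation rV := 'rV[R]_m.+1.
Implicit Types (gamma f : rV -> R[i]) (v : R -> R[i]) (x xi : rV)
  (P S : seq (R[i] * R)) (b : R[i] * R) (p q s a del D L : R).
Local Notation "''e_0'" := (delta_mx 0 0 : rV).

Lemma prod_decay_sub_first k xi (c : R) : \prod_(i < m.+1) decay k ((xi - c *: 'e_0) 0 i) =
  decay k (xi 0 0 - c) * \prod_(i < m) decay k (xi 0 (lift ord0 i)).
Proof.
rewrite big_ord_recl !mxE !eqxx mulr1; congr (_ * _); apply: eq_bigr => i _.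
by rewrite !mxE andbF mulr0 subr0.
Qed.

Lemma modnorm_separated_le gamma f p q s : schwartz gamma -> schwartz f ->
  1 <= p -> 1 < s -> s < q -> exists2 K : R, 0 <= K &
  forall S L a, 0 <= a -> {in S, forall b, cmod b.1 = a} -> 0 < L -> separated L S ->
    (size S)%:R <= L ->
    (modnorm gamma p q (coord_mult (trig S) f) <= ((K * (a `^ q * (size S)%:R `^ s)) `^ q^-1)%:E)%E.
Proof.
move=> sg sf p1 s1 sq; have [M M0 VM] := stft_decay sf sg.
have [q1 q0 s0] : [/\ 1 < q, 0 < q & 0 < s] by split; lra.
exists ((2 ^+ m.+1) `^ (q / p) * (M `^ q * 3 `^ (q - s) * (2 / (s - 1)) * (2 / (q - 1)) ^+ m)).
  by rewrite !mulr_ge0 ?powR_ge0 ?exprn_ge0 ?invr_ge0 ?mulr_ge0 ?invr_ge0 ?subr_ge0 // ltW.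
move=> S L a a0 Sa L0 sep SL.
pose B xi := M * a * sum_decay S (xi 0 0) * \prod_(i < m) decay 1 (xi 0 (lift ord0 i)).
pose g (i : nat) : R -> R := if i is 0
  then (fun y => \sum_(b <- S) decay 1 (y - b.2) `^ s) else (fun y => decay 1 y `^ q).
pose I (i : nat) : R := if i is 0 then (size S)%:R * (2 / (s - 1)) else 2 / (q - 1).
pose c := (M * a) `^ q * (3 `^ (q - s) * (size S)%:R `^ (s - 1)).
rewrite [X in (X `^ _)%:E](_ : _ = (2 ^+ m.+1) `^ (q / p) * c * \prod_(i < m.+1) I i); last first.
  rewrite big_ord_recl /= prodr_const card_ord /c (powRM _ M0 a0).
  by rewrite -(mulr_powRB1 (ler0n R (size S)) s0); ring.
apply: (@modnorm_le_prod _ _ gamma p q _ B c g I p1) => //.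
- move=> x xi; rewrite stft_coord_mult_trig // (le_trans (ler_cmod_sum _ _)) //.
  rewrite /B /sum_decay mulr_sumr !mulr_suml big_seq [leRHS]big_seq ler_sum // => b bS.
  rewrite cmodM Sa // -!mulrA [leRHS]mulrCA ler_wpM2l // (le_trans (VM _ _)) //.
  by rewrite prod_decay_sub_first; lra.
- by move=> xi; rewrite !mulr_ge0 ?sum_decay_ge0 ?prod_decay_ge0.
- by rewrite !mulr_ge0 ?powR_ge0.
- move=> xi; rewrite /B powRM ?mulr_ge0 ?sum_decay_ge0 ?prod_decay_ge0 //.
  rewrite powR_prod => [|i]; last exact: decay_ge0.
  rewrite big_ord_recl /= mulrA ler_wpM2r //; first by apply: prodr_ge0 => i _; exact: powR_ge0.
  rewrite powRM ?mulr_ge0 ?sum_decay_ge0 // /c -2!mulrA ler_wpM2l ?powR_ge0 //.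
  exact: sum_decay_powR_le L0 SL sep.
- move=> [|i] /=; last by apply: continuous_measurable_fun; exact: decay_powR_continuous.
  by apply: measurable_sum => b; exact: measurable_decay_powR.
- by move=> [|i] y; rewrite ?powR_ge0 //; apply: sumr_ge0 => b _; exact: powR_ge0.
- move=> [|i] /=; first exact: integral_sum_decay_powR.
  exact: integral_decay1_powR.
Qed.

Lemma stft_isolated_peak_ge gamma : schwartz gamma -> (exists t, gamma t != 0) ->
  exists c r M, [/\ 0 < c, 0 < r & 0 <= M] /\ forall b S v del D x xi,
    ccontinuous v -> (forall y, cmod (v y - trig (b :: S) y) <= del) ->
    isolated D b S -> 2 * r <= D ->
    (forall i, `|x 0 i| <= r) -> (forall i, `|(xi - b.2 *: 'e_0) 0 i| <= r) ->
    c * cmod b.1 - M * (l1norm S / D + del) <= cmod (stft gamma (coord_mult v gamma) x xi).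
Proof.
move=> sg g0; have [c [r [c0 r0 near_origin]]] := stft_ge_near_origin sg g0.
have [A A0 VA] := stft_decay sg sg; have [B B0 VB] := stft_coord_mult_le sg sg.
exists c, r, (2 * A + B); split=> [|b S v del D x xi cv vdel iso rD xr xir].
  by split=> //; rewrite addr_ge0 // mulr_ge0.
have D0 : 0 < D by lra.
have del0 : 0 <= del := le_trans (cmod_ge0 _) (vdel 0).
have cE := ccontinuousB cv (ccontinuous_trig (b :: S)).
have -> : v = (fun y => trig (b :: S) y + (v y - trig (b :: S) y)).
  by apply/funext => y; rewrite subrKC.
rewrite (stft_coord_multD _ _ sg sg (ccontinuous_trig _) cE (cmod_trig_le _) vdel).
rewrite stft_coord_mult_trig // big_cons.
have peak : c * cmod b.1 <= cmod (b.1 * stft gamma gamma x (xi - b.2 *: 'e_0)).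
  by rewrite cmodM mulrC ler_wpM2l ?cmod_ge0 // near_origin.
have tail : cmod (\sum_(b' <- S) b'.1 * stft gamma gamma x (xi - b'.2 *: 'e_0)) <=
    A * (2 / D) * l1norm S.
  rewrite (le_trans (ler_cmod_sum _ _)) // mulrC /l1norm mulr_suml big_seq [leRHS]big_seq.
  apply: ler_sum => b' b'S; rewrite cmodM ler_wpM2l ?cmod_ge0 // (le_trans (VA _ _)) //.
  have far : D / 2 <= `|xi 0 0 - b'.2|.
    have := iso b' b'S; have := xir 0; rewrite !mxE eqxx mulr1.
    by have := ler_distD (xi 0 0) b.2 b'.2; rewrite (distrC b.2 (xi 0 0)); lra.
  rewrite prod_decay_sub_first -mulrA ler_wpM2l //.
  rewrite -[leRHS]mul1r ler_pM ?mulr_ge0 ?prod_decay_ge0 ?prod_decay_le1 ?decay_ge0 //.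
  rewrite -[leRHS]mulr1 ler_pM ?prod_decay_ge0 ?prod_decay_le1 ?decay_ge0 // -invf_div.
  by apply: decay1_le far; rewrite divr_gt0.
have error := VB _ _ x xi cE vdel.
have := lerB_cmodD (b.1 * stft gamma gamma x (xi - b.2 *: 'e_0) +
  \sum_(b' <- S) b'.1 * stft gamma gamma x (xi - b'.2 *: 'e_0))
  (stft gamma (coord_mult (fun y => v y - trig (b :: S) y) gamma) x xi).
have := lerB_cmodD (b.1 * stft gamma gamma x (xi - b.2 *: 'e_0))
  (\sum_(b' <- S) b'.1 * stft gamma gamma x (xi - b'.2 *: 'e_0)).
have SD0 : 0 <= l1norm S / D by rewrite divr_ge0 ?l1norm_ge0 ?ltW.
have := mulr_ge0 B0 SD0; have := mulr_ge0 A0 del0.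
by move: tail; rewrite (_ : A * (2 / D) * l1norm S = 2 * A * (l1norm S / D)); [lra|ring].
Qed.

Lemma modnorm_separated_peaks_ge gamma p q : schwartz gamma -> (exists t, gamma t != 0) ->
  0 < p -> 0 < q -> exists K M, [/\ 0 < K, 0 < M & forall P S v a del D,
    0 < a -> {in P, forall b, cmod b.1 = a} ->
    {in P, forall b, isolated D b (rem b P ++ S)} ->
    ccontinuous v -> (forall y, cmod (v y - trig (P ++ S) y) <= del) ->
    M <= D -> M * l1norm (P ++ S) <= a * D -> M * del <= a ->
    (((K * a `^ q * (size P)%:R) `^ q^-1)%:E <= modnorm gamma p q (coord_mult v gamma))%E].
Proof.
move=> sg g0 p0 q0; have [c [r [M [[c0 r0 M0] peak]]]] := stft_isolated_peak_ge sg g0.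
pose K := ((2 * r) ^+ m.+1) `^ (q / p) * (2 * r) ^+ m.+1 * (c / 2) `^ q.
exists K, (4 * M / c + 3 * r); split.
- by rewrite /K !mulr_gt0 ?powR_gt0 ?exprn_gt0 ?divr_gt0 ?mulr_gt0.
- by rewrite ltr_wpDl ?mulr_gt0 // divr_ge0 ?mulr_ge0 ?(ltW c0).
move=> P S v a del D a0 Pa iso cv vdel MD Ml Mdel.
have Mc0 : 0 <= 4 * M / c by rewrite divr_ge0 ?mulr_ge0 ?(ltW c0).
have rD : 2 * r < D by lra.
have D0 : 0 < D by lra.
have sep : separated D P by move=> b bP b' b'P; apply: iso => //; rewrite mem_cat b'P.
have l0 := l1norm_ge0 (P ++ S).
have del0 : 0 <= del := le_trans (cmod_ge0 _) (vdel 0).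
have small : M * (l1norm (P ++ S) / D + del) <= c / 2 * a.
  rewrite mulrDr mulrA -(ler_pM2l (x := 4 / c)) ?divr_gt0 // mulrDr.
  rewrite (_ : 4 / c * (c / 2 * a) = a + a); last by field; lra.
  apply: lerD.
    rewrite !mulrA ler_pdivrMr //; apply: le_trans Ml.
    by rewrite [4 / c * M]mulrAC ler_wpM2r // lerDl mulr_ge0 // ltW.
  apply: le_trans Mdel.
  by rewrite mulrA [4 / c * M]mulrAC ler_wpM2r // lerDl mulr_ge0 // ltW.
rewrite (_ : K * _ * _ = ((2 * r) ^+ m.+1) `^ (q / p) * (2 * r) ^+ m.+1 * (c / 2 * a) `^ q *
  (size [seq b.2 | b <- P])%:R); last by
  rewrite size_map powRM ?divr_ge0 ?(ltW c0) ?(ltW a0) // /K; ring.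
apply: modnorm_ge_separated_boxes => //;
  rewrite ?(ltW r0) ?mulr_ge0 ?divr_ge0 ?(ltW c0) ?(ltW a0) //.
- exact: separated_uniq sep.
- move=> _ _ /mapP[b bP ->] /mapP[b' b'P ->] bb'.
  exact: lt_le_trans rD (separated_freq_neq sep bP b'P bb').
move=> x xi _ /mapP[b bP ->] xr xir.
have perm : perm_eq (P ++ S) (b :: rem b P ++ S) by rewrite -cat_cons perm_cat2r perm_to_rem.
have vdel' y : cmod (v y - trig (b :: rem b P ++ S) y) <= del.
  by rewrite /trig -(perm_big _ perm).
apply: le_trans (peak _ _ _ _ _ _ _ cv vdel' (iso b bP) (ltW rD) xr xir).
have : l1norm (rem b P ++ S) <= l1norm (P ++ S).
  by rewrite /l1norm (perm_big _ perm) big_cons lerDr cmod_ge0.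
rewrite Pa // => rest_le; have : M * (l1norm (rem b P ++ S) / D + del) <= c / 2 * a.
  by apply: le_trans small; rewrite ler_wpM2l // lerD2r ler_wpM2r // invr_ge0 ltW.
lra.
Qed.

End ModulationNormOfTrigonometricMultiples.

Section FlatScaleAsymptotics.
Context {R : realType}.
Implicit Types (q s Z e : R).

Lemma flat_scale_powR a q s :
  flat_scale a `^ q * (2 ^+ a) `^ s = 2 `^ (- (q / 2)) * (2 `^ (s - q / 2)) ^+ a :> R.
Proof.
have two0 : 0 <= 2 :> R by [].
have -> : flat_scale a = 2 `^ (- (a.+1%:R / 2)) :> R.
  by rewrite powRN powRrM powR12_sqrt ?powR_ge0 // powR_mulrn.
rewrite -(powR_mulrn a two0) -(powR_mulrn a (powR_ge0 _ _)) -!powRrM.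
by rewrite -!powRD ?pnatr_eq0 ?implybT //; congr (_ `^ _); rewrite -natr1; ring.
Qed.

Lemma flat_scale_powR_small q s e : s < q / 2 -> 0 < e ->
  exists a, flat_scale a `^ q * (2 ^+ a) `^ s < e.
Proof.
move=> sq e0; pose b : R := 2 `^ (s - q / 2).
have b1 : `|b| < 1.
  rewrite ger0_norm ?powR_ge0 // /b -(opprB (q / 2)) powRN invf_lt1 ?powR_gt0 //.
  have sq0 : 0 < q / 2 - s by rewrite subr_gt0.
  by have := @gt0_ltr_powR _ _ sq0 1 2; rewrite powR1; apply; rewrite ?nnegrE // ltr1n.
have /cvgr0Pnorm_lt/(_ _ e0)[a _ /(_ a (leqnn a))] := cvg_geometric (2 `^ (- (q / 2))) b1.
by rewrite /= ger0_norm ?mulr_ge0 ?exprn_ge0 ?powR_ge0 // /b -flat_scale_powR; exists a.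
Qed.

Lemma flat_scale_powR_large q Z : q < 2 -> exists a, Z < flat_scale a `^ q * 2 ^+ a.
Proof.
move=> q2; have Z0 : 0 < `|Z| + 1 by rewrite ltr_wpDl.
have q2' : -1 < - q / 2 by lra.
have Zinv0 : 0 < (`|Z| + 1)^-1 by rewrite invr_gt0.
have [a] := flat_scale_powR_small q2' Zinv0.
rewrite powR_inv1 ?exprn_ge0 // powRN -invfM ltf_pV2 ?posrE ?mulr_gt0 ?powR_gt0 ?exprn_gt0 //;
  last exact: flat_scale_gt0.
by exists a; have := ler_norm Z; lra.
Qed.

Lemma lt_powR_inv (X Y : R) q : 0 < q -> 0 <= Y -> Y `^ q < X -> Y < X `^ q^-1.
Proof.
move=> q0 Y0 YX; rewrite -[Y](powRr1 Y0) -(divff (lt0r_neq0 q0)) powRrM.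
by apply: gt0_ltr_powR; rewrite ?invr_gt0 ?nnegrE ?powR_ge0 // (le_trans (powR_ge0 _ _) (ltW YX)).
Qed.

End FlatScaleAsymptotics.

Section Humps.
Context {R : realType} {m : nat}.
Implicit Types (gamma f : 'rV[R]_m.+1 -> R[i]) (u v : R -> R[i]) (T S : seq (R[i] * R))
  (p q A e kap del : R).
Local Open Scope complex_scope.

Definition multiplier_norm_gt gamma p q A u := exists2 f, schwartz f &
  (A%:E * modnorm gamma p q f < modnorm gamma p q (coord_mult u f))%E.

Definition is_hump (P : (R -> R[i]) -> Prop) S kap T del :=
  [/\ 0 < del, forall y, cmod (trig T y) <= kap & forall v, ccontinuous v ->
    (forall y, cmod (v y - trig (T ++ S) y) <= del) -> P v].

Definition stable_hump P S kap := exists T del, is_hump P S kap T del.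

Lemma exists_spacing (M l c : R) : 0 <= M -> 0 <= l -> 0 < c ->
  exists2 D, M <= D & M * l <= c * D.
Proof.
move=> M0 l0 c0; exists (M + M * l / c); first by rewrite lerDl divr_ge0 ?mulr_ge0 // ltW.
by rewrite mulrDr [c * (_ / c)]mulrC divfK ?gt_eqF // lerDr mulr_ge0 // ltW.
Qed.

Lemma modnorm_flat_small gamma f p q : schwartz gamma -> schwartz f -> 1 <= p -> 2 < q ->
  forall e, 0 < e -> exists a, forall L, 2 ^+ a <= `|L| ->
    (modnorm gamma p q (coord_mult (trig (harmonics (flat_coefs 1 a) L)) f) <= e%:E)%E.
Proof.
move=> sg sf p1 q2 e e0; have q0 : 0 < q by lra.
have [s [s1 sq2 sq]] : exists s, [/\ 1 < s, s < q / 2 & s < q].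
  by exists ((1 + q / 2) / 2); split; lra.
have [K K0 upper] := modnorm_separated_le sg sf p1 s1 sq.
have K1 : 0 < K + 1 by rewrite ltr_wpDl.
have [a] := flat_scale_powR_small sq2 (divr_gt0 (powR_gt0 q e0) K1).
rewrite ltr_pdivlMr // => small; exists a => L aL.
have scale0 := flat_scale_gt0 a (R := R).
have L0 : 0 < `|L| by rewrite (lt_le_trans _ aL) // exprn_gt0.
apply: le_trans (upper _ _ (flat_scale a) (ltW scale0) _ L0 _ _) _.
- by move=> b /(cmod_harmonics (norm_flat_coefs ler01)) ->; rewrite mul1r.
- by apply: separated_harmonics; rewrite -normr_gt0.
- by rewrite size_harmonics size_flat_coefs natrX.
rewrite size_harmonics size_flat_coefs natrX lee_fin.
have mass0 : 0 <= flat_scale a `^ q * (2 ^+ a) `^ s by rewrite mulr_ge0 ?powR_ge0.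
have -> : e = (e `^ q) `^ q^-1 by rewrite -powRrM divff ?gt_eqF // powRr1 // ltW.
apply: ge0_ler_powR; rewrite ?nnegrE ?invr_ge0 ?mulr_ge0 ?powR_ge0 ?(ltW q0) //.
by apply/ltW/(le_lt_trans _ small); rewrite mulrC ler_wpM2l // lerDl.
Qed.

Lemma hump_lt2 gamma p q : schwartz gamma -> (exists t, gamma t != 0) -> 1 < p -> 1 < q -> q < 2 ->
  forall A S kap, 0 <= A -> 0 < kap -> stable_hump (multiplier_norm_gt gamma p q A) S kap.
Proof.
move=> sg g0 p1 q1 q2 A S kap A0 kap0; have [p0 q0] : 0 < p /\ 0 < q by split; lra.
have [K [M [K0 M0 peaks]]] := modnorm_separated_peaks_ge sg g0 p0 q0.
have [B gammaB] := modnorm_schwartz_lty sg sg (ltW p1) q1.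
have [a] := flat_scale_powR_large ((`|A * B|) `^ q / (K * kap `^ q)) q2.
rewrite ltr_pdivrMr ?mulr_gt0 ?powR_gt0 // => large.
have scale0 := flat_scale_gt0 a (R := R).
have c0 : 0 < kap * flat_scale a by rewrite mulr_gt0.
set c := kap * flat_scale a in c0.
have l0 : 0 <= 2 ^+ a * c + l1norm S by rewrite addr_ge0 ?l1norm_ge0 // mulr_ge0 ?exprn_ge0 // ltW.
have [D MD MlD] := exists_spacing (ltW M0) l0 c0.
have [L DS] : exists L, D + freq_bound S = L by exists (D + freq_bound S).
have DL : D <= L by rewrite -DS lerDl freq_bound_ge0.
have L0 : 0 < L by rewrite (lt_le_trans M0) // (le_trans MD).
pose T := harmonics (flat_coefs kap a) L.
have isoT : {in T, forall b, isolated D b (rem b T ++ S)}.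
  move=> b bT; apply: isolated_cat.
    apply: isolated_le DL _; rewrite -(gtr0_norm L0).
    by apply: separated_harmonics; rewrite ?gt_eqF.
  apply: (isolated_large (L := L)); last by rewrite DS.
  by rewrite -{1}(gtr0_norm L0); exact: harmonics_freq_large bT.
exists T, (c / M).
split; [by rewrite divr_gt0|by move=> y; exact: cmod_trig_flat_le (ltW kap0)|].
move=> v cv vT; exists gamma => //.
apply: lt_le_trans (peaks T S v c (c / M) D c0 _ isoT cv vT MD _ _).
- apply: (@le_lt_trans _ _ (`|A * B|%:E)).
    apply: le_trans (lee_wpmul2l _ gammaB) _; first by rewrite lee_fin.
    by rewrite -EFinM lee_fin ler_norm.
  rewrite lte_fin size_harmonics size_flat_coefs natrX; apply: lt_powR_inv => //.
  by rewrite powRM ?(ltW kap0) ?(ltW scale0) //; move: large; lra.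
- exact: cmod_harmonics (norm_flat_coefs (ltW kap0)).
- by rewrite l1norm_cat l1norm_flat // ltW.
- by rewrite mulrC divfK // gt_eqF.
Qed.

(* Multiplication by the conjugate flat polynomial concentrates the flat polynomial at the
   frequency [0]. *)
Lemma trig_flat_demodulation S kap a L D : 0 <= kap -> 0 < L -> D + freq_bound S <= L ->
  exists rest, [/\ forall y, trig (harmonics (flat_coefs kap a) L ++ S) y *
        trig (harmonics (flat_coefs 1 a) (- L)) y = trig (((kap / 2)%:C, 0) :: rest) y,
      l1norm rest <= (2 ^+ a * (kap * flat_scale a) + l1norm S) * (2 ^+ a * flat_scale a) &
      isolated D ((kap / 2)%:C, 0) rest].
Proof.
move=> kap0 L0 DL; pose off := off_diagonal (flat_coefs kap a) (flat_coefs 1 a) L.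
exists (off ++ trig_mul S (harmonics (flat_coefs 1 a) (- L))); split.
- move=> y; rewrite trig_cons (trig_cat off) trigM mul0r expi0 mulr1 addrA.
  by rewrite -trig_flatM ?gt_eqF // trig_cat mulrDl.
- have -> : 2 ^+ a * flat_scale a = l1norm (harmonics (flat_coefs 1 a) (- L)).
    by rewrite l1norm_flat ?ler01 // mul1r.
  rewrite l1norm_cat l1normM mulrDl lerD2r -(l1norm_flat a L kap0) -l1normM.
  exact: l1norm_filter.
- have DL' : D <= L by have := freq_bound_ge0 S; lra.
  apply: isolated_cat => [b /off_diagonal_freq_large|].
    by rewrite sub0r normrN gtr0_norm //; exact: le_trans.
  apply: isolated_trig_mul DL => b /harmonics_freq_large.
  by rewrite normrN gtr0_norm.
Qed.

Lemma hump_gt2 gamma p q : schwartz gamma -> (exists t, gamma t != 0) -> 1 < p -> 2 < q ->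
  forall A S kap, 0 <= A -> 0 < kap -> stable_hump (multiplier_norm_gt gamma p q A) S kap.
Proof.
move=> sg g0 p1 q2 A S kap A0 kap0; have [p0 q0] : 0 < p /\ 0 < q by split; lra.
have [K [M [K0 M0 peaks]]] := modnorm_separated_peaks_ge sg g0 p0 q0.
have c0 : 0 < kap / 2 by rewrite divr_gt0.
pose low := (K * (kap / 2) `^ q) `^ q^-1.
have low0 : 0 < low by rewrite powR_gt0 // mulr_gt0 // powR_gt0.
have A1 : 0 < A + 1 by rewrite ltr_wpDl.
have [a small] := modnorm_flat_small sg sg (ltW p1) q2 (divr_gt0 low0 A1).
pose l := kap / 2 + (2 ^+ a * (kap * flat_scale a) + l1norm S) * (2 ^+ a * flat_scale a).
have l0 : 0 <= l.
  by rewrite !(addr_ge0, mulr_ge0) ?l1norm_ge0 ?exprn_ge0 ?invr_ge0 ?sqrtr_ge0 ?(ltW kap0).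
have [D MD MlD] := exists_spacing (ltW M0) l0 c0.
have [L [L0 DS aL]] : exists L, [/\ 0 < L, D + freq_bound S <= L & 2 ^+ a <= L].
  exists (D + freq_bound S + 2 ^+ a); have a0 : 0 < 2 ^+ a :> R by rewrite exprn_gt0.
  by have := freq_bound_ge0 S; split; lra.
pose Tbar := harmonics (flat_coefs 1 a) (- L).
have [rest [TTbar rest_l iso]] := trig_flat_demodulation a (ltW kap0) L0 DS.
exists (harmonics (flat_coefs kap a) L), (kap / 2 / M).
split; [by rewrite divr_gt0|by move=> y; exact: cmod_trig_flat_le (ltW kap0)|].
move=> v cv vT; exists (coord_mult (trig Tbar) gamma); first exact: schwartz_coord_mult_trig.
have -> : coord_mult v (coord_mult (trig Tbar) gamma) =
    coord_mult (fun y => v y * trig Tbar y) gamma.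
  by apply/funext => t; rewrite /coord_mult mulrA.
pose peak := ((kap / 2)%:C, 0) : R[i] * R.
have vTbar y : cmod (v y * trig Tbar y - trig ([:: peak] ++ rest) y) <= kap / 2 / M.
  rewrite -TTbar -mulrBl cmodM (le_trans _ (vT y)) // ler_piMr ?cmod_ge0 //.
  exact: cmod_trig_flat_le.
apply: lt_le_trans (peaks [:: peak] rest _ _ _ D c0 _ _
  (ccontinuousM cv (ccontinuous_trig Tbar)) vTbar MD _ _).
- apply: le_lt_trans (lee_wpmul2l _ (small (- L) _)) _; first by rewrite lee_fin.
    by rewrite normrN gtr0_norm.
  rewrite -EFinM lte_fin mulr1 -/low mulrA ltr_pdivrMr // mulrC ltr_pM2l //.
  by rewrite ltrDl.
- by move=> b; rewrite inE => /eqP ->; rewrite cmod_real gtr0_norm.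
- by move=> b; rewrite inE => /eqP ->; rewrite /= eqxx.
- rewrite /l1norm big_cons cmod_real gtr0_norm // -/(l1norm rest).
  by apply: le_trans MlD; rewrite ler_wpM2l ?(ltW M0) // lerD2l.
- by rewrite mulrC divfK // gt_eqF.
Qed.

End Humps.

Section UniformLimits.
Context {R : realType}.
Implicit Types (x kap : R^nat).

Definition halving kap := forall k, 0 <= kap k /\ 2 * kap k.+1 <= kap k.

Lemma halving_cvg0 kap : halving kap -> kap @ \oo --> 0.
Proof.
move=> kh; have geo : geometric (kap 0%N) 2^-1 @ \oo --> 0.
  by apply: cvg_geometric; rewrite ger0_norm ?invr_ge0 // invf_lt1 // ltr1n.
apply: (squeeze_cvgr _ (cvg_cst 0) geo); apply: nearW => k; rewrite (kh k).1 /=.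
elim: k => [|k IH]; first by rewrite expr0 mulr1.
by have := (kh k).2; rewrite exprS; move: IH; lra.
Qed.

Lemma halving_increments_limit x kap : halving kap ->
  (forall k, `|x k.+1 - x k| <= kap k) -> exists l, forall k, `|l - x k| <= 2 * kap k.
Proof.
move=> kh xk; pose a k := x k - 2 * kap k; pose b k := x k + 2 * kap k.
have nda : nondecreasing_seq a.
  by apply/nondecreasing_seqP => k; have := (kh k).2; have := xk k; rewrite ler_norml /a; lra.
have nib : nonincreasing_seq b.
  by apply/nonincreasing_seqP => k; have := (kh k).2; have := xk k; rewrite ler_norml /b; lra.
have ba0 : b - a @ \oo --> 0.
  rewrite (_ : b - a = (fun k => 4 * kap k)); last first.
    by apply/funext => k; rewrite !fctE /b /a; ring.
  by rewrite -(mulr0 4); apply: cvgMl_tmp; exact: halving_cvg0.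
have [lim_ba ca cb] := adjacent_seq nda nib ba0.
exists (limn a) => k; have := nondecreasing_cvgn_le nda ca k.
have := nonincreasing_cvgn_ge nib cb k; rewrite lim_ba ler_norml /a /b; lra.
Qed.

Lemma uniform_approx_continuous (w : nat -> R -> R) (l : R -> R) (e : R^nat) :
  (forall k, continuous (w k)) -> (forall k y, `|l y - w k y| <= e k) -> e @ \oo --> 0 ->
  continuous l.
Proof.
move=> cw lw e0; apply: (@uniform_limit_continuous _ _ (w @ \oo)).
  by exists 0%N => // k _; exact: cw.
move=> P /uniform_nbhs[E []]; rewrite -entourage_from_ballE => -[d d0 dE] EP.
suff : \forall k \near \oo, P (w k) by [].
near=> k; apply: EP => y _; apply: dE.
rewrite /= /ball /= (le_lt_trans (lw k y)) // (le_lt_trans (ler_norm _)) //.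
by near: k; move/cvgr0Pnorm_lt: e0; apply.
Unshelve. all: by end_near. Qed.

Lemma ccontinuous_halving_limit (w : nat -> R -> R[i]) kap : halving kap ->
  (forall k, ccontinuous (w k)) -> (forall k y, cmod (w k.+1 y - w k y) <= kap k) ->
  exists2 u, ccontinuous u & forall k y, cmod (u y - w k y) <= 4 * kap k.
Proof.
move=> kh cw wk.
have limit (proj : R[i] -> R) : {morph proj : z z' / z - z'} -> (forall z, `|proj z| <= cmod z) ->
    (forall k, continuous (fun y => proj (w k y))) ->
    exists2 l, continuous l & forall k y, `|l y - proj (w k y)| <= 2 * kap k.
  move=> projB proj_le cproj.
  have pointwise y : exists l, forall k, `|l - proj (w k y)| <= 2 * kap k.
    apply: halving_increments_limit kh _ => k.
    by rewrite -projB (le_trans (proj_le _)).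
  have [l lE] := boolp.choice pointwise; exists l => [|k y]; last exact: lE.
  apply: (uniform_approx_continuous cproj (fun k y => lE y k)).
  by rewrite -(mulr0 2); apply: cvgMl_tmp; exact: halving_cvg0.
have [l1 c1 l1E] := limit _ (raddfB (@complex.Re R : Rcomplex R -> R))
  (@normr_Re_le R) (fun k => (cw k).1).
have [l2 c2 l2E] := limit _ (raddfB (@complex.Im R : Rcomplex R -> R))
  (@normr_Im_le R) (fun k => (cw k).2).
exists (fun y => Complex (l1 y) (l2 y)) => // k y.
rewrite (le_trans (cmod_le_Re_Im _)) // !raddfB /=.
by have := l1E k y; have := l2E k y; lra.
Qed.

End UniformLimits.

Section GlidingHump.
Context {R : realType}.
Implicit Types (S T : seq (R[i] * R)) (kap del : R) (u v : R -> R[i]).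
Variable P : nat -> (R -> R[i]) -> Prop.
Hypothesis hump : forall k S kap, 0 < kap -> stable_hump (P k) S kap.

Lemma hump_sequence : exists (S : nat -> seq (R[i] * R)) (kap : R^nat),
  [/\ S 0%N = [::], kap 0%N = 4^-1, halving kap,
    forall k y, cmod (trig (S k.+1) y - trig (S k) y) <= kap k &
    forall k v, ccontinuous v -> (forall y, cmod (v y - trig (S k.+1) y) <= 4 * kap k.+1) -> P k v].
Proof.
pose good (state : nat * (seq (R[i] * R) * R)) (step : seq (R[i] * R) * R) :=
  let: (k, (Q, kap)) := state in 0 < kap -> is_hump (P k) Q kap step.1 step.2.
have step_exists state : exists step, good state step.
  case: state => k [Q kap].
  have [kap0|kap0] := ltrP 0 kap; last by exists ([::], 0); rewrite /good ltNge kap0.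
  by have [T [del h]] := hump k Q kap0; exists (T, del).
have [step step_good] := boolp.choice step_exists.
pose next k S_kap := let: (T, del) := step (k, S_kap) in
  (T ++ S_kap.1, Num.min (S_kap.2 / 2) (del / 4)).
pose state := fix state k := if k is k'.+1 then next k' (state k') else ([::], 4^-1).
have stateS k : 0 < (state k).2 -> exists T del,
    is_hump (P k) (state k).1 (state k).2 T del /\
    state k.+1 = (T ++ (state k).1, Num.min ((state k).2 / 2) (del / 4)).
  rewrite /= /next; have := step_good (k, state k); rewrite /good.
  case: (state k) => Q kap /=; case: (step _) => T del h kap0.
  by exists T, del; split=> //; exact: h.
have kap0 k : 0 < (state k).2.
  elim: k => [|k IH]; first by rewrite /= invr_gt0.
  by have [T [del [[del0 _ _] ->]]] := stateS k IH; rewrite /= lt_min !divr_gt0.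
exists (fun k => (state k).1), (fun k => (state k).2); split=> // [k|k y|k v cv].
- have [T [del [_ ->]]] := stateS k (kap0 k); split; first exact: ltW.
  have : Num.min ((state k).2 / 2) (del / 4) <= (state k).2 / 2 by rewrite ge_min lexx.
  by rewrite /=; lra.
- have [T [del [[_ Tkap _] ->]]] := stateS k (kap0 k).
  by rewrite trig_cat addrK.
- have [T [del [[_ _ TP] ->]]] := stateS k (kap0 k) => vT; apply: TP => // y.
  apply: le_trans (vT y) _.
  have : Num.min ((state k).2 / 2) (del / 4) <= del / 4 by rewrite ge_min lexx orbT.
  by rewrite /=; lra.
Qed.

Lemma gliding_hump : exists u, [/\ ccontinuous u, forall y, cmod (u y) <= 1 & forall k, P k u].
Proof.
have [S [kap [S0 kap0 kh Sk SP]]] := hump_sequence.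
have [u cu uS] := ccontinuous_halving_limit kh (fun k => ccontinuous_trig (S k)) Sk.
exists u; split=> // [y|k]; last by apply: SP => // y; exact: uS.
by have := uS 0%N y; rewrite S0 trig_nil subr0 kap0 mulfV.
Qed.

End GlidingHump.

Section MultiplicationOperator.
Context {R : realType} {m : nat}.
Local Notation rV := 'rV[R]_m.+1.
Implicit Types (u : R -> R[i]) (f g : rV -> R[i]).

Lemma continuous_borel (h : rV -> R) : continuous h -> borel_fun h.
Proof.
by move=> ch U oU; apply: sub_sigma_algebra; move/continuousP: ch; exact.
Qed.

Lemma cint0 : cint (fun _ : rV => 0 : R[i]) = 0.
Proof.
transitivity (Complex (fine 0%E) (fine 0%E) : R[i]); last by [].
by congr Complex; exact: (congr1 fine (iterint0 m.+1)).
Qed.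

Lemma borel_coord_mult u f : ccontinuous u -> schwartz f -> borel_cfun (coord_mult u f).
Proof.
move=> [ur ui] /schwartz_continuous[fr fi].
have cu (w : R -> R) : continuous w -> continuous (fun t : rV => w (t 0 0)).
  by move=> cw t; apply: (@continuous_comp _ _ _ (fun t : rV => t 0 0) w);
    [exact: coord_continuous|exact: cw].
split; apply: continuous_borel => t; rewrite /coord_mult.
- under eq_fun do rewrite ReM.
  exact: (continuousB (continuousM (cu _ ur t) (fr t)) (continuousM (cu _ ui t) (fi t))).
- under eq_fun do rewrite ImM.
  exact: (continuousD (continuousM (cu _ ur t) (fi t)) (continuousM (cu _ ui t) (fr t))).
Qed.

Lemma L2sq_coord_mult u f : (forall y, cmod (u y) <= 1) ->
  (L2sq (coord_mult u f) <= L2sq f)%E.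
Proof.
move=> u1; apply: iterint_le => [s|s _]; first by rewrite lee_fin sqr_ge0.
rewrite lee_fin; apply: lerXn2r; rewrite ?nnegrE ?cmod_ge0 //.
by rewrite cmodM ler_piMl ?cmod_ge0.
Qed.

Lemma CZ_kernel0 : CZ_kernel (fun _ _ : rV => 0 : R[i]) 1 1.
Proof.
split=> [|||x x' y _|x y y' _]; rewrite ?ltr01 ?lexx //.
- by move=> x y _; rewrite cmod0 divr_ge0 // exprn_ge0 // sqrtr_ge0.
- by rewrite subrr cmod0 divr_ge0 ?mulr_ge0 ?powR_ge0.
- by rewrite subrr cmod0 divr_ge0 ?mulr_ge0 ?powR_ge0.
Qed.

Lemma mul_disjoint_supp f g t : supp f `&` supp g = set0 -> f t * g t = 0.
Proof.
move=> disj; have [->|ft] := eqVneq (f t) 0; first by rewrite mul0r.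
have [->|gt] := eqVneq (g t) 0; first by rewrite mulr0.
suff : (supp f `&` supp g) t by rewrite disj.
by split; apply: subset_closure.
Qed.

Lemma CZ_operator_coord_mult u : ccontinuous u -> (forall y, cmod (u y) <= 1) ->
  CZ_operator (@coord_mult R m u).
Proof.
move=> cu u1; split.
- by move=> f; exact: borel_coord_mult.
- by move=> a f g _ _; apply/funext => t; rewrite /coord_mult; ring.
- by exists 1 => f _; rewrite expr1n mul1e; exact: L2sq_coord_mult.
- exists (fun _ _ => 0), 1, 1; split; first exact: CZ_kernel0.
  move=> f g _ _ disj; congr cint; apply/funext => x.
  have -> : (fun y : rV => 0 * f y) = (fun=> 0) by apply/funext => y; rewrite mul0r.
  by rewrite cint0 mul0r /coord_mult -mulrA mul_disjoint_supp // mulr0.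
Qed.

End MultiplicationOperator.

Theorem theorem1p2 (R : realType) (n : nat) (p q : R) :
  (0 < n)%N -> 1 < p -> 1 < q -> q != 2 ->
  forall gamma : 'rV[R]_n -> R[i], schwartz gamma -> (exists x, gamma x != 0) ->
  exists T : ('rV[R]_n -> R[i]) -> ('rV[R]_n -> R[i]),
    CZ_operator T /\
    ~ (exists C : R, forall f : 'rV[R]_n -> R[i], schwartz f ->
         (modnorm gamma p q (T f) <= C%:E * modnorm gamma p q f)%E).
Proof.
case: n => [//|m] _ p1 q1 q2 gamma sg g0.
have [u [cu u1 unbounded]] : exists u, [/\ ccontinuous u, forall y, cmod (u y) <= 1 &
    forall k : nat, multiplier_norm_gt gamma p q k%:R u].
  apply: gliding_hump => k S kap.
  have [ql|qg|qe] := ltgtP q 2; last by rewrite qe eqxx in q2.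
  - exact: hump_lt2.
  - exact: hump_gt2.
exists (coord_mult u); split; first exact: CZ_operator_coord_mult.
move=> [C bound]; have [f sf] := unbounded (Num.truncn C).+1.
rewrite ltNge => /negP; apply; apply: le_trans (bound f sf) _.
by rewrite lee_wpmul2r ?poweR_ge0 // lee_fin ltW // truncnS_gt.
Qed.
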